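(* Let $\mathcal{G}=\langle a,b\rangle\le \mathrm{Aut}(T)$ be the second Grigorchuk group acting on the $4$-adic tree $T$. Then: (i) the logarithmic orders of the congruence quotients of $\mathcal{G}$ are given by $$\log_4|\mathcal{G}:\mathrm{St}_{\mathcal{G}}(n)| = \begin{cases} 1 & \text{if } n=1,\\ 3 & \text{if } n=2,\\ \frac{1}{3}\big(86\cdot 4^{n-4}+4\big) & \text{if } n>2;\end{cases}$$ (ii) the Hausdorff dimension of the closure $\overline{\mathcal{G}}$ of $\mathcal{G}$ in $\Gamma$ is $$\mathrm{hdim}_\Gamma(\overline{\mathcal{G}})=\frac{43}{128}.$$
   Context: Let $X=\{1,2,3,4\}$ and let $T$ be the $4$-adic (regular rooted) tree whose vertices are identified with the words in the free monoid $X^*$: the root is the empty word, and each word $\omega$ is joined by an edge to $\omega x$ for each $x\in X$. The words of length $n$ form the $n$th level (layer). $\mathrm{Aut}(T)$ is the group of automorphisms of $T$ (fixing the root), acting on the right. For $f\in\mathrm{Aut}(T)$ and a vertex $u$, the section $f_u\in\mathrm{Aut}(T)$ is defined by $(uv)^f=u^f v^{f_u}$ for all $v\in X^*$. For a subgroup $H\le\mathrm{Aut}(T)$, $\mathrm{St}_H(n)$ is the $n$th level stabiliser, i.e. the subgroup of elements of $H$ fixing every vertex of level $n$. The map $\psi:\mathrm{St}_{\mathrm{Aut}(T)}(1)\to\mathrm{Aut}(T)^4$, $\psi(f)=(f_1,f_2,f_3,f_4)$, is an isomorphism. The second Grigorchuk group is $\mathcal{G}=\langle a,b\rangle\le\mathrm{Aut}(T)$,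 where $a$ is the rooted automorphism corresponding to the cycle $(1\ 2\ 3\ 4)$ (that is, $(xv)^a=x^{(1\,2\,3\,4)}v$ for $x\in X$, $v\in X^*$), and $b\in\mathrm{St}_{\mathrm{Aut}(T)}(1)$ is recursively defined by $\psi(b)=(a,1,a,b)$. $\Gamma=\varprojlim_{n\in\mathbb{N}} C_4\wr\overset{n}{\cdots}\wr C_4\le\mathrm{Aut}(T)$ is the group of all $4$-adic automorphisms, i.e. those automorphisms of $T$ whose induced permutation of $X$ at each vertex is a power of the cycle $(1\ 2\ 3\ 4)$. It is a profinite group with the level stabilisers $\mathrm{St}_\Gamma(n)$ as a basis of open neighbourhoods of the identity, and $\overline{G}$ denotes the closure of $G$ in $\Gamma$. For $G\le\Gamma$, the Hausdorff dimension of the closure of $G$ in $\Gamma$ is given by $$\mathrm{hdim}_\Gamma(\overline{G})=\varliminf_{n\to\infty}\frac{\log|G:\mathrm{St}_G(n)|}{\log|\Gamma:\mathrm{St}_\Gamma(n)|}\in[0,1],$$ where $\varliminf$ denotes the lower limit. *)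

(* Defs.v *)
From HB Require Import structures.
From mathcomp Require Import all_boot all_order all_fingroup all_algebra.
From mathcomp Require Import finmap.
From mathcomp Require Import all_classical all_reals all_analysis.

Set Implicit Arguments.
Unset Strict Implicit.
Unset Printing Implicit Defensive.

Import Order.TTheory GRing.Theory Num.Theory.

Local Open Scope classical_set_scope.
Local Open Scope ring_scope.

(* The letters 1, 2, 3, 4 are represented by 0, 1, 2, 3 : 'I_4. *)
Definition vertex : Type := seq 'I_4.

Definition adj (u v : vertex) : bool :=
  [exists x : 'I_4, (v == rcons u x) || (u == rcons v x)].

(* f u stands for the image u^f; the action is on the right, see treeAut_mul. *)
Record treeAut := TreeAut {
  treeAut_fun :> vertex -> vertex;
  treeAut_bij : bijective treeAut_fun;
  treeAut_root : treeAut_fun [::] = [::];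
  treeAut_adj : forall u v, adj (treeAut_fun u) (treeAut_fun v) = adj u v
}.

Lemma treeAutP (f g : treeAut) : f =1 g -> f = g.
Proof.
case: f g => f f1 f2 f3 [g g1 g2 g3] /= /funext fg; subst g.
by congr TreeAut; exact: Prop_irrelevance.
Qed.

Lemma treeAut_rcons (f : treeAut) u x : exists y, f (rcons u x) = rcons (f u) y.
Proof.
have adjf v y : adj (f v) (f (rcons v y)).
  by rewrite treeAut_adj; apply/existsP; exists y; rewrite eqxx.
elim/last_ind: u x => [|u z IHu] x.
  have /existsP[y /orP[/eqP ->|]] := adjf [::] x; first by exists y.
  by rewrite treeAut_root; case: (f _).
have /existsP[y /orP[/eqP ->|]] := adjf (rcons u z) x; first by exists y.
have [t ->] := IHu z; rewrite eqseq_rcons => /andP[/eqP fE _].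
have /(congr1 size) := bij_inj (treeAut_bij f) fE.
by rewrite !size_rcons => /eqP; rewrite ltn_eqF// leqW.
Qed.

Lemma size_treeAut (f : treeAut) u : size (f u) = size u.
Proof.
elim/last_ind: u => [|u x IHu]; first by rewrite treeAut_root.
by have [y ->] := treeAut_rcons f u x; rewrite !size_rcons IHu.
Qed.

Lemma treeAut_cat (f : treeAut) u v :
  f (u ++ v) = f u ++ drop (size u) (f (u ++ v)).
Proof.
elim/last_ind: v => [|v x IHv].
  by rewrite cats0 drop_oversize ?size_treeAut ?cats0.
have [y] := treeAut_rcons f (u ++ v) x; rewrite -rcons_cat => ->.
rewrite drop_rcons ?size_treeAut ?size_cat ?leq_addr//.
by rewrite {1}IHv rcons_cat.
Qed.

Lemma adj_cat p u v : adj (p ++ u) (p ++ v) = adj u v.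
Proof.
apply: eq_existsb => x; rewrite -!cats1 -!catA.
by rewrite !eqseq_cat ?eqxx.
Qed.

Section MakeTreeAut.
Variables (f g : vertex -> vertex).
Hypotheses (fK : cancel f g) (gK : cancel g f).
Hypothesis f0 : f [::] = [::].
Hypothesis fS : forall u x, exists y, f (rcons u x) = rcons (f u) y.
Hypothesis gS : forall u x, exists y, g (rcons u x) = rcons (g u) y.

Let adj_homo (h : vertex -> vertex) :
  (forall u x, exists y, h (rcons u x) = rcons (h u) y) ->
  forall u v, adj u v -> adj (h u) (h v).
Proof.
move=> hS u v /existsP[x /orP[] /eqP ->]; apply/existsP.
  by have [y ->] := hS u x; exists y; rewrite eqxx.
by have [y ->] := hS v x; exists y; rewrite eqxx orbT.
Qed.

Lemma mkTreeAut_adj u v : adj (f u) (f v) = adj u v.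
Proof.
by apply/idP/idP => [/(adj_homo gS)|/(adj_homo fS)//]; rewrite !fK.
Qed.

Definition mkTreeAut : treeAut := TreeAut (Bijective fK gK) f0 mkTreeAut_adj.
End MakeTreeAut.

HB.instance Definition _ := gen_eqMixin treeAut.
HB.instance Definition _ := gen_choiceMixin treeAut.

Definition treeAut_one : treeAut :=
  @TreeAut id (Bijective (frefl id) (frefl id)) erefl (fun _ _ => erefl).

Section TreeAutMul.
Variables f g : treeAut.

Fact treeAut_mul_bij : bijective (g \o f).
Proof. by apply: bij_comp; exact: treeAut_bij. Qed.

Fact treeAut_mul_root : (g \o f) [::] = [::].
Proof. by rewrite /= !treeAut_root. Qed.

Fact treeAut_mul_adj u v : adj ((g \o f) u) ((g \o f) v) = adj u v.
Proof. by rewrite /= !treeAut_adj. Qed.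

(* right actions: u^(fg) = (u^f)^g *)
Definition treeAut_mul : treeAut :=
  TreeAut treeAut_mul_bij treeAut_mul_root treeAut_mul_adj.
End TreeAutMul.

Section TreeAutInv.
Variable f : treeAut.

Fact treeAut_inv_ex : {g : vertex -> vertex | cancel f g & cancel g f}.
Proof. by apply: cid2; case: (treeAut_bij f) => g fK gK; exists g. Qed.

Let g := s2val treeAut_inv_ex.
Let fK : cancel f g := s2valP treeAut_inv_ex.
Let gK : cancel g f := s2valP' treeAut_inv_ex.

Fact treeAut_inv_root : g [::] = [::].
Proof. by rewrite -[in LHS](treeAut_root f) fK. Qed.

Fact treeAut_inv_adj u v : adj (g u) (g v) = adj u v.
Proof. by rewrite -(treeAut_adj f) !gK. Qed.

Definition treeAut_inv : treeAut :=
  TreeAut (Bijective gK fK) treeAut_inv_root treeAut_inv_adj.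
End TreeAutInv.

Fact treeAut_mulA : associative treeAut_mul.
Proof. by move=> f g h; exact: treeAutP. Qed.
Fact treeAut_mul1 : left_id treeAut_one treeAut_mul.
Proof. by move=> f; exact: treeAutP. Qed.
Fact treeAut_mulr1 : right_id treeAut_one treeAut_mul.
Proof. by move=> f; exact: treeAutP. Qed.
Fact treeAut_mulV : left_inverse treeAut_one treeAut_inv treeAut_mul.
Proof.
by move=> f; apply: treeAutP; exact: s2valP' (treeAut_inv_ex f).
Qed.
Fact treeAut_mulrV : right_inverse treeAut_one treeAut_inv treeAut_mul.
Proof.
by move=> f; apply: treeAutP; exact: s2valP (treeAut_inv_ex f).
Qed.

HB.instance Definition _ := isGroup.Build treeAut treeAut_mulA treeAut_mul1
  treeAut_mulr1 treeAut_mulV treeAut_mulrV.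

Lemma treeAut1E u : (1%g : treeAut) u = u.
Proof. by []. Qed.

Lemma treeAutME (f g : treeAut) u : (f * g)%g u = g (f u).
Proof. by []. Qed.

Lemma treeAutK (f : treeAut) : cancel f f^-1%g.
Proof. by move=> u; rewrite -treeAutME mulgV. Qed.

Lemma treeAutKV (f : treeAut) : cancel f^-1%g f.
Proof. by move=> u; rewrite -treeAutME mulVg. Qed.

Lemma section_bij (f : treeAut) u :
  bijective (fun v => drop (size u) (f (u ++ v))).
Proof.
exists (fun v => drop (size u) (f^-1%g (f u ++ v))) => v.
  by rewrite -treeAut_cat treeAutK drop_size_cat.
have := treeAut_cat f^-1%g (f u) v; rewrite treeAutK size_treeAut => <-.
by rewrite treeAutKV drop_size_cat// size_treeAut.
Qed.

Lemma section_root (f : treeAut) u : drop (size u) (f (u ++ [::])) = [::].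
Proof. by rewrite cats0 drop_oversize// size_treeAut. Qed.

Lemma section_adj (f : treeAut) u v w :
  adj (drop (size u) (f (u ++ v))) (drop (size u) (f (u ++ w))) = adj v w.
Proof. by rewrite -(adj_cat (f u)) -!treeAut_cat treeAut_adj adj_cat. Qed.

Definition treeSection (f : treeAut) (u : vertex) : treeAut :=
  TreeAut (section_bij f u) (section_root f u) (section_adj f u).

Lemma treeSectionE (f : treeAut) u v : f (u ++ v) = f u ++ treeSection f u v.
Proof. exact: treeAut_cat. Qed.

Definition St (H : set treeAut) (n : nat) : set treeAut :=
  [set f | H f /\ forall u, size u = n -> f u = u].

Definition psi (f : treeAut) : 4.-tuple treeAut :=
  [tuple treeSection f [:: x] | x < 4].

Definition rooted_fun (s : {perm 'I_4}) (w : vertex) : vertex :=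
  if w is x :: v then s x :: v else [::].

Lemma rooted_funK s : cancel (rooted_fun s) (rooted_fun s^-1%g).
Proof. by case=> [|x v] //=; rewrite permK. Qed.

Lemma rooted_funKV s : cancel (rooted_fun s^-1%g) (rooted_fun s).
Proof. by case=> [|x v] //=; rewrite permKV. Qed.

Lemma rooted_fun_rcons s u x :
  exists y, rooted_fun s (rcons u x) = rcons (rooted_fun s u) y.
Proof. by case: u => [|z u] /=; [exists (s x)|exists x]. Qed.

Definition rooted (s : {perm 'I_4}) : treeAut :=
  mkTreeAut (rooted_funK s) (rooted_funKV s) erefl
    (@rooted_fun_rcons s) (@rooted_fun_rcons s^-1%g).

(* the cycle (1 2 3 4): ordS i is i + 1 modulo 4 *)
Definition cyc4 : {perm 'I_4} := perm (@ordS_inj 4).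

Definition gen_a : treeAut := rooted cyc4.

(* The function of b is b_fun gen_a, that of b^-1 is b_fun gen_a^-1. *)
Fixpoint b_fun (f : vertex -> vertex) (w : vertex) : vertex :=
  if w is x :: v then
    x :: match val x with
         | 0 | 2 => f v
         | 1 => v
         | _ => b_fun f v
         end
  else [::].

Lemma b_funK f g : cancel f g -> cancel (b_fun f) (b_fun g).
Proof.
move=> fK; elim=> [|[[|[|[|[|x]]]] x4] v IHv] //=; by rewrite ?fK ?IHv.
Qed.

Lemma b_fun_rcons (f : treeAut) u x :
  exists y, b_fun f (rcons u x) = rcons (b_fun f u) y.
Proof.
elim: u => [|[[|[|[|[|z]]]] z4] u [y IHu]] //=.
- by exists x; case: x => [[|[|[|[|x]]]] x4] //=; rewrite treeAut_root.
- by have [t ->] := treeAut_rcons f u x; exists t.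
- by exists x.
- by have [t ->] := treeAut_rcons f u x; exists t.
- by exists y; rewrite IHu.
Qed.

Definition gen_b : treeAut :=
  mkTreeAut (b_funK (treeAutK gen_a)) (b_funK (treeAutKV gen_a)) erefl
    (@b_fun_rcons gen_a) (@b_fun_rcons gen_a^-1%g).

Lemma gen_b_St1 : St setT 1 gen_b.
Proof.
split=> // -[|[[|[|[|[|x]]]] x4] [|y u]] //= _.
Qed.

Lemma psi_gen_b : psi gen_b = [tuple gen_a; 1%g; gen_a; gen_b].
Proof.
apply: eq_from_tnth => i; rewrite tnth_mktuple; apply: treeAutP => v.
by case: i => [[|[|[|[|i]]]] i4]; rewrite (tnth_nth 1%g) //= drop0.
Qed.

Definition subgroup (H : set treeAut) : Prop := group_closed [in H].

Definition gen (A : set treeAut) : set treeAut := smallest subgroup A.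

Definition Grigorchuk2 : set treeAut := gen [set gen_a; gen_b].

(* The number of right cosets K h with h in H (0 if there are infinitely
   many). *)
Definition subgroup_index (H K : set treeAut) : nat :=
  #|` fset_set [set [set (k * h)%g | k in K] | h in H] |.

Definition Gamma : set treeAut :=
  [set f | forall u, exists k : nat, forall x : 'I_4,
    treeSection f u [:: x] = [:: (cyc4 ^+ k)%g x]].

(* The topology on Aut(T) having the cosets f St(n) as basic neighbourhoods
   of f; the profinite topology of Gamma is the induced one. *)
HB.instance Definition _ := hasNbhs.Build treeAut (fun f : treeAut =>
  filter_from setT (fun n => [set (f * g)%g | g in St setT n])).

Lemma cosetStE (f g : treeAut) n :
  [set (f * s)%g | s in St setT n] g <-> forall u, size u = n -> f u = g u.
Proof.
split=> [[s [_ sn] <-] u un|fg].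
  by rewrite treeAutME sn// size_treeAut.
exists (f^-1 * g)%g; last by rewrite mulKVg.
split=> // u un; rewrite treeAutME -fg ?treeAutKV//.
by rewrite size_treeAut.
Qed.

Lemma level_eq_le (f g : treeAut) m n : (m <= n)%N ->
  (forall u, size u = n -> f u = g u) -> forall u, size u = m -> f u = g u.
Proof.
move=> mn fg u um; have := fg (u ++ nseq (n - m) ord0).
rewrite size_cat size_nseq um subnKC// => /(_ erefl) /(congr1 (take m)).
by rewrite !treeSectionE !take_size_cat// size_treeAut.
Qed.

Fact treeAut_nbhs_filter (f : treeAut) : ProperFilter (nbhs f).
Proof.
apply: filter_from_proper; last by move=> n _; exists f; apply/cosetStE.
apply: filter_from_filter; first by exists 0%N.
move=> m n _ _; exists (maxn m n) => // g /cosetStE fg; split; apply/cosetStE.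
  by apply: level_eq_le fg; exact: leq_maxl.
by apply: level_eq_le fg; exact: leq_maxr.
Qed.

Fact treeAut_nbhs_singleton (f : treeAut) (A : set treeAut) : nbhs f A -> A f.
Proof. by case=> n _; apply; apply/cosetStE. Qed.

Fact treeAut_nbhs_nbhs (f : treeAut) (A : set treeAut) :
  nbhs f A -> nbhs f (nbhs^~ A).
Proof.
case=> n _ fA; exists n => // g /cosetStE fg; exists n => // h /cosetStE gh.
by apply/fA/cosetStE => u un; rewrite fg// gh.
Qed.

HB.instance Definition _ := Nbhs_isNbhsTopological.Build treeAut
  treeAut_nbhs_filter treeAut_nbhs_singleton treeAut_nbhs_nbhs.

Definition closure_Gamma (G : set treeAut) : set treeAut :=
  Gamma `&` closure G.

(* The Hausdorff dimension in Gamma of a closed subgroup H of Gamma.  When H is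
   the closure of G, the indices can be computed in G: see hdim_closure. *)
Definition hdim_Gamma (R : realType) (H : set treeAut) : \bar R :=
  limn_einf (fun n =>
    (ln (subgroup_index H (St H n))%:R / ln (subgroup_index Gamma (St Gamma n))%:R)%:E).

Definition log4 (R : realType) (x : R) : R := ln x / ln 4.

Lemma subgroupP (H : set treeAut) :
  subgroup H <-> H 1%g /\ forall f g, H f -> H g -> H (f * g^-1)%g.
Proof.
split=> [[H1 HV]|[H1 HV]].
  split=> [|f g Hf Hg]; first by move: H1; rewrite inE.
  by have := HV f g; rewrite !inE; apply.
by split=> [|f g]; rewrite !inE; [|exact: HV].
Qed.

Lemma subgroupM (H : set treeAut) : subgroup H ->
  forall f g, H f -> H g -> H (f * g)%g.
Proof.
move=> /subgroupP[H1 HV] f g Hf Hg; rewrite -(invgK g); apply: (HV) => //.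
by rewrite -(mul1g g^-1%g); exact: HV.
Qed.

Definition level_action (n : nat) (f : treeAut) :
  {ffun n.-tuple 'I_4 -> n.-tuple 'I_4} := [ffun t : n.-tuple 'I_4 => insubd t (f t)].

Lemma level_actionP n (f g : treeAut) :
  level_action n f = level_action n g <-> forall u, size u = n -> f u = g u.
Proof.
split=> [/ffunP fg u /eqP un|fg].
  have := congr1 val (fg (Tuple un)); rewrite !ffunE !val_insubd /=.
  by rewrite !size_treeAut un.
apply/ffunP => t; rewrite !ffunE; congr insubd; apply: fg.
exact: size_tuple.
Qed.

Lemma index_StE (H : set treeAut) n : subgroup H ->
  subgroup_index H (St H n) = #|` fset_set [set level_action n h | h in H] |.
Proof.
move=> sH; have [H1 HV] := (subgroupP H).1 sH.
pose F r := [set f | H f /\ level_action n f = r].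
have finA : finite_set [set level_action n h | h in H] by exact: finite_finset.
have -> : subgroup_index H (St H n) =
    #|` fset_set (F @` [set level_action n h | h in H]) |.
  rewrite /subgroup_index image_comp; congr #|` fset_set _ |.
  apply: eq_imagel => h Hh; apply/seteqP; split=> [_ [k [Hk kn] <-]|f [Hf]].
    split; first exact: subgroupM.
    by apply/level_actionP => u un; rewrite treeAutME kn.
  move/level_actionP=> fh; exists (f * h^-1)%g; last by rewrite mulgVK.
  split; first exact: HV.
  by move=> u un; rewrite treeAutME fh// treeAutK.
rewrite fset_set_image// card_in_imfset//= => r s.
rewrite !in_fset_set// !inE => -[h Hh hr] _ /seteqP[+ _].
by move=> /(_ h (conj Hh hr))[_ <-].
Qed.

Lemma closureP (G : set treeAut) f : closure G f <->
  forall n, exists2 g, G g & forall u, size u = n -> f u = g u.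
Proof.
split=> [fG n|fG B [n _ fB]].
  have [|g [Gg /cosetStE fg]] := fG [set (f * s)%g | s in St setT n].
    by exists n.
  by exists g.
by have [g Gg fg] := fG n; exists g; split=> //; apply/fB/cosetStE.
Qed.

Lemma subgroup_closure (G : set treeAut) : subgroup G -> subgroup (closure G).
Proof.
move=> /subgroupP[G1 GV]; apply/subgroupP; split=> [|f g /closureP fG /closureP gG].
  exact: subset_closure.
apply/closureP => n; have [f' Gf ff'] := fG n; have [g' Gg gg'] := gG n.
exists (f' * g'^-1)%g; first exact: GV.
move=> u un; rewrite !treeAutME ff'//.
have sfn : size (f' u) = n by rewrite size_treeAut.
have sgn : size (g'^-1%g (f' u)) = n by rewrite size_treeAut.
by rewrite -{1}(treeAutKV g' (f' u)) -gg'// treeAutK.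
Qed.

Lemma treeSectionM (f g : treeAut) u v :
  treeSection (f * g)%g u v = treeSection g (f u) (treeSection f u v).
Proof.
have := treeSectionE (f * g)%g u v.
rewrite !treeAutME (treeSectionE f) (treeSectionE g) => /eqP.
by rewrite eqseq_cat// => /andP[_ /eqP].
Qed.

Lemma treeSectionV (f : treeAut) u :
  cancel (treeSection f (f^-1%g u)) (treeSection f^-1%g u).
Proof.
move=> v; have := treeSectionM f f^-1%g (f^-1%g u) v.
by rewrite treeAutKV mulgV => <- /=; rewrite drop_size_cat.
Qed.

Lemma subgroup_Gamma : subgroup Gamma.
Proof.
apply/subgroupP; split=> [u|f g fG gG u].
  by exists 0%N => x; rewrite expg0 perm1 /= drop_size_cat.
have [k fk] := fG u; have [m gm] := gG (g^-1%g (f u)).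
have /cycleP[j jE] : ((cyc4 ^+ k) * (cyc4 ^+ m)^-1)%g \in <[cyc4]>%g.
  by rewrite groupM ?groupV ?mem_cycle.
exists j => x; rewrite -jE treeSectionM fk permM.
set y := (cyc4 ^+ k)%g x; set z := ((cyc4 ^+ m)^-1)%g y.
have <- : treeSection g (g^-1%g (f u)) [:: z] = [:: y] by rewrite gm permKV.
exact: treeSectionV.
Qed.

Lemma Gamma_gen_a : Gamma gen_a.
Proof.
case=> [|y u]; first by exists 1%N => x; rewrite expg1 /=.
by exists 0%N => x; rewrite expg0 perm1 /= drop_size_cat.
Qed.

Lemma Gamma_gen_b : Gamma gen_b.
Proof.
elim=> [|[[|[|[|[|y]]]] y4] u IHu] //=.
- by exists 0%N => -[[|[|[|[|x]]]] x4]; rewrite expg0 perm1 //= drop0 ?treeAut_root.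
- exact: Gamma_gen_a.
- by exists 0%N => x; rewrite expg0 perm1 /= drop_size_cat.
- exact: Gamma_gen_a.
Qed.

Lemma subgroup_Grigorchuk2 : subgroup Grigorchuk2.
Proof.
apply/subgroupP; split=> [H [/subgroupP[]//]|f g fG gG H].
move=> HP; have [/subgroupP[_ HV] _] := HP.
by apply: HV; [exact: fG|exact: gG].
Qed.

Lemma Grigorchuk2_Gamma : Grigorchuk2 `<=` Gamma.
Proof.
apply: smallest_sub; first exact: subgroup_Gamma.
by move=> _ [|] ->; [exact: Gamma_gen_a|exact: Gamma_gen_b].
Qed.

Lemma subgroup_closure_Gamma (G : set treeAut) :
  subgroup G -> subgroup (closure_Gamma G).
Proof.
move=> /subgroup_closure/subgroupP[c1 cV].
have /subgroupP[g1 gV] := subgroup_Gamma; apply/subgroupP; split=> //.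
by move=> f g [Gf cf] [Gg cg]; split; [exact: gV|exact: cV].
Qed.

Lemma index_closure (G : set treeAut) n : subgroup G -> G `<=` Gamma ->
  subgroup_index (closure_Gamma G) (St (closure_Gamma G) n) = subgroup_index G (St G n).
Proof.
move=> sG GG; rewrite !index_StE//; last exact: subgroup_closure_Gamma.
congr #|` fset_set _ |; apply/seteqP; split=> [_ [f [_ /closureP cf] <-]|].
  by have [g Gg fg] := cf n; exists g => //; apply/level_actionP => u /fg.
move=> _ [g Gg <-]; exists g => //; split; first exact: GG.
exact: subset_closure.
Qed.

Lemma hdim_closure (R : realType) (G : set treeAut) :
  subgroup G -> G `<=` Gamma ->
  hdim_Gamma R (closure_Gamma G) =
  limn_einf (fun n =>
    (ln (subgroup_index G (St G n))%:R / ln (subgroup_index Gamma (St Gamma n))%:R)%:E).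
Proof.
move=> sG GG; rewrite /hdim_Gamma; congr limn_einf; apply/funext => n.
by rewrite index_closure.
Qed.

(* Main.v *)
Require Import Defs.
From mathcomp Require Import all_boot all_order all_fingroup all_algebra.
From mathcomp Require Import all_classical all_reals all_analysis.
From mathcomp Require Import finmap ring lra zify.

Import Order.TTheory GRing.Theory Num.Theory numFieldNormedType.Exports.

Set Implicit Arguments.
Unset Strict Implicit.
Unset Printing Implicit Defensive.

Local Open Scope ring_scope.

(** Let G be the group and let f_x denote the section of f at the letter x;
    letters are added modulo 4, and a translates them by 1.  Counting the level
    quotients of G reduces to describing the image of psi by congruences modulo
    4, which goes as follows.

    Invariants.  The abelianisation of G is C_4 x C_4, and both exponents can be
    read off the top of the tree: the exponent of a is the label [lbl f] of the
    root, and that of b is [bexp f] = lbl f_0 + lbl f_1, because b has labels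
    1, 0, 1, 0 on the first level.  The stabiliser of the first level is
    generated by the four conjugates (a, 1, a, b), (1, a, b, a), (a, b, a, 1)
    and (b, a, 1, a) of b, and each coordinate has the letter b in exactly one
    of them; so [cnt f j] = bexp f_j is the exponent of one conjugate of b, and
    (lbl, cnt) maps G onto C_4 wr C_4.  Finally G modulo the third term of its
    lower central series is the Heisenberg group of Z/4, and its central
    coordinate [heis] is a linear combination of the numbers cnt f j ([heisM]).
    Induction on words in a and b expresses the labels and the sum of the
    central coordinates of the sections of f by the numbers cnt f j ([lbl_sec],
    [hsumE]).

    The image of psi.  Let [abker] be the kernel of (lbl, bexp) and [cntker]
    that of (lbl, cnt); these are the derived subgroups of G and of its first
    level stabiliser.  The formulas above show that every element of cntker has
    its four sections in abker, with central coordinates adding up to 0.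
    Conversely all such elements are in cntker ([cntkerP]).  Indeed the
    commutator of (a, 1, a, b) and (b, a, 1, a) is (c, 1, 1, c^-1) with
    c = [a, b], and further commutators with conjugates of b isolate a single
    coordinate: the group [rist] of those g with (g, 1, 1, 1) in G is normal
    and contains [c, a] and [c^-1, b], so it contains everything on which lbl,
    bexp and heis vanish.  Modulo rist an element of abker is a power of c, and
    the tuples of powers of c with exponent sum 0 are products of rotations of
    (c, 1, 1, c^-1).

    Counting.  Write g_n, d_n and m_n for the numbers of actions on level n of
    elements of G, abker and cntker.  The invariants lbl, bexp and cnt are
    visible on levels 1, 2 and 3, so g_n = 16 d_n for n >= 2 and d_n = 64 m_n
    for n >= 3.  The condition on the sum of the coordinates heis is visible on
    level 4, so d_(n-1)^4 = 4 m_n for n >= 4, hence g_n = g_(n-1)^4 / 2^8.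
    On level 3 only the parity of that sum survives, which gives d_2^4 = 2 m_3;
    with d_2 = 4 this yields g_2 = 2^6 and g_3 = 2^17.  The exceptional
    values for small n come from these thresholds.  For Gamma the recursion is
    4 times a fourth power, and the quotient of the logarithms tends to
    43 / 128. *)

(** * Sections, and automorphisms with prescribed sections *)

Definition sec (f : treeAut) (x : 'I_4) : treeAut := treeSection f [:: x].

Definition lbl (f : treeAut) : 'I_4 := head 0 (f [:: 0]).

Lemma ordS_add1 (x : 'I_4) : ordS x = x + 1.
Proof. by apply: val_inj => /=; rewrite modnDmr addn1. Qed.

Lemma cyc4X k x : (cyc4 ^+ k)%g x = x + k%:R.
Proof.
elim: k => [|k IHk]; first by rewrite expg0 perm1 addr0.
by rewrite expgSr permM IHk permE ordS_add1 -addrA natr1.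
Qed.

Lemma Gamma_letter f x : Gamma f -> f [:: x] = [:: x + lbl f].
Proof.
move=> /(_ [::])[k fk].
have fE y : f [:: y] = [:: y + k%:R].
  by rewrite -cyc4X -fk /= drop0.
by rewrite /lbl !fE /= add0r.
Qed.

Lemma treeAut_cons f x v : Gamma f -> f (x :: v) = x + lbl f :: sec f x v.
Proof. by move=> fG; rewrite -cat1s treeSectionE Gamma_letter. Qed.

Lemma Gamma_sec f x : Gamma f -> Gamma (sec f x).
Proof.
move=> fG u; have [k fk] := fG (x :: u); exists k => y; rewrite -fk /=.
by rewrite drop_drop addn1.
Qed.

Lemma GammaM f g : Gamma f -> Gamma g -> Gamma (f * g)%g.
Proof. exact: subgroupM subgroup_Gamma f g. Qed.

Lemma lblM f g : Gamma f -> Gamma g -> lbl (f * g)%g = lbl f + lbl g.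
Proof.
move=> fG gG; have := Gamma_letter 0 (GammaM fG gG).
by rewrite treeAutME !Gamma_letter// !add0r => -[].
Qed.

Lemma secM f g x : Gamma f -> sec (f * g)%g x = (sec f x * sec g (x + lbl f))%g.
Proof.
move=> fG; apply: treeAutP => v.
by rewrite /sec treeSectionM Gamma_letter.
Qed.

(** The element fixing the first level with sections [t x], that is, the inverse
    of psi; functions on the letters replace tuples of length 4 so that products
    and rotations are computed pointwise. *)
Definition mk_fun (t : 'I_4 -> treeAut) (w : vertex) : vertex :=
  if w is x :: v then x :: t x v else [::].

Lemma mk_funK t : cancel (mk_fun t) (mk_fun (fun x => (t x)^-1)%g).
Proof. by case=> [|x v] //; congr (_ :: _); exact: treeAutK. Qed.

Lemma mk_funKV t : cancel (mk_fun (fun x => (t x)^-1)%g) (mk_fun t).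
Proof. by case=> [|x v] //; congr (_ :: _); exact: treeAutKV. Qed.

Lemma mk_fun_rcons t u x : exists y, mk_fun t (rcons u x) = rcons (mk_fun t u) y.
Proof.
case: u => [|z u] /=; first by exists x; rewrite treeAut_root.
by have [y ->] := treeAut_rcons (t z) u x; exists y.
Qed.

Definition mk (t : 'I_4 -> treeAut) : treeAut :=
  mkTreeAut (mk_funK t) (mk_funKV t) erefl
    (@mk_fun_rcons t) (@mk_fun_rcons (fun x => (t x)^-1)%g).

Lemma sec_mk t x : sec (mk t) x = t x.
Proof. by apply: treeAutP => v; rewrite /sec /= drop0. Qed.

Lemma lbl_mk t : lbl (mk t) = 0.
Proof. by []. Qed.

Lemma eq_mk s t : s =1 t -> mk s = mk t.
Proof. by move=> /funext ->. Qed.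

Lemma mkM s t : (mk s * mk t)%g = mk (fun x => s x * t x)%g.
Proof. by apply: treeAutP => -[|x v]. Qed.

Lemma mk1 : mk (fun=> 1%g) = 1%g.
Proof. by apply: treeAutP => -[|x v]. Qed.

Lemma mkV t : ((mk t)^-1)%g = mk (fun x => (t x)^-1)%g.
Proof.
apply: (mulgI (mk t)); rewrite mulgV mkM -mk1.
by apply: eq_mk => x; rewrite mulgV.
Qed.

Lemma mk_sec f : Gamma f -> lbl f = 0 -> mk (sec f) = f.
Proof.
move=> fG f0; apply: treeAutP => -[|x v]; first by rewrite !treeAut_root.
by rewrite (treeAut_cons _ _ fG) f0 addr0.
Qed.

Lemma Gamma_mk t : (forall x, Gamma (t x)) -> Gamma (mk t).
Proof.
move=> tG [|x u].
  by exists 0%N => x; rewrite expg0 perm1 /= treeAut_root.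
have [k tk] := tG x u; exists k => y; by rewrite -tk.
Qed.

Local Notation a := gen_a.
Local Notation b := gen_b.

Lemma lbl_a : lbl a = 1.
Proof. by rewrite /lbl /= permE ordS_add1 add0r. Qed.

Lemma lbl_b : lbl b = 0. Proof. by []. Qed.

Lemma sec_a x : sec a x = 1%g.
Proof. by apply: treeAutP => v; rewrite /sec /= drop0. Qed.

Definition bsec (x : 'I_4) : treeAut :=
  match val x with 0 | 2 => a | 1 => 1%g | _ => b end.

Lemma sec_b x : sec b x = bsec x.
Proof.
have := congr1 (fun t => tnth t x) psi_gen_b; rewrite /= tnth_mktuple /sec => ->.
by rewrite (tnth_nth 1%g) /bsec; case: x => [[|[|[|[|x]]]] x4].
Qed.

Lemma b_mk : b = mk bsec.
Proof.
rewrite -(mk_sec Gamma_gen_b lbl_b); apply: eq_mk => x; exact: sec_b.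
Qed.

Lemma a4 : (a ^+ 4 = 1)%g.
Proof.
apply: treeAutP => -[|x v]; first exact: treeAut_root.
rewrite !expgS expg0 !treeAutME treeAut1E /= !permE.
by congr (_ :: _); apply: val_inj; case: x => [[|[|[|[|x]]]] x4].
Qed.

Lemma b4 : (b ^+ 4 = 1)%g.
Proof.
have a4w w : a (a (a (a w))) = w.
  by have : (a ^+ 4)%g w = w by rewrite a4.
apply: treeAutP => v; rewrite !expgS expg0 !treeAutME !treeAut1E.
elim: v => [|[[|[|[|[|x]]]] x4] v IHv] //; congr (_ :: _); by [exact: a4w|exact: IHv].
Qed.

(** Conjugation by a rotates the coordinates. *)
Lemma mkJa t : (a^-1 * (mk t * a) = mk (fun x => t (x - 1)))%g.
Proof.
apply: (mulgI a); rewrite mulKVg; apply: treeAutP => -[|x v].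
  by rewrite !treeAut_root.
rewrite !treeAutME (_ : mk t (x :: v) = x :: t x v)//.
rewrite !(treeAut_cons _ _ Gamma_gen_a) lbl_a !sec_a !treeAut1E.
by rewrite (_ : mk _ (_ :: v) = x + 1 :: t (x + 1 - 1) v)// addrK.
Qed.

(** * Induction on words and self-similarity *)

Local Notation G := Grigorchuk2.

Lemma G_a : G a.
Proof. by move=> H [_]; apply; left. Qed.

Lemma G_b : G b.
Proof. by move=> H [_]; apply; right. Qed.

Lemma G_1 : G 1%g.
Proof. by have [] := (subgroupP _).1 subgroup_Grigorchuk2. Qed.

Lemma G_M f g : G f -> G g -> G (f * g)%g.
Proof. exact: subgroupM subgroup_Grigorchuk2 f g. Qed.

Lemma G_V f : G f -> G (f^-1)%g.
Proof.
have [G1 GV] := (subgroupP _).1 subgroup_Grigorchuk2.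
by move=> Gf; rewrite -[(_^-1)%g]mul1g; exact: GV.
Qed.

Lemma G_X f n : G f -> G (f ^+ n)%g.
Proof.
move=> Gf; elim: n => [|n IHn]; first exact: G_1.
by rewrite expgS; exact: G_M.
Qed.

Lemma G_J f g : G f -> G g -> G (f ^ g)%g.
Proof. by move=> Gf Gg; rewrite conjgE; apply: G_M; [exact: G_V|exact: G_M]. Qed.

Lemma G_R f g : G f -> G g -> G [~ f, g]%g.
Proof. by move=> Gf Gg; rewrite commgEl; apply: G_M; [exact: G_V|exact: G_J]. Qed.

#[local] Hint Resolve G_a G_b G_1 : core.

Definition eval_word (w : seq bool) : treeAut :=
  foldr (fun x f => if x then a * f else b * f)%g 1%g w.

Lemma eval_word_cat v w : eval_word (v ++ w) = (eval_word v * eval_word w)%g.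
Proof.
elim: v => [|x v IHv] /=; first by rewrite mul1g.
by rewrite IHv; case: x; rewrite mulgA.
Qed.

(** No inverses are needed, as a and b have order 4. *)
Lemma G_eval_word f : G f -> exists w, f = eval_word w.
Proof.
move=> Gf; suff : [set g | exists w, g = eval_word w]%classic f by [].
apply: Gf; split; last first.
  by move=> _ [] ->; [exists [:: true]|exists [:: false]]; rewrite /= mulg1.
apply/subgroupP; split; first by exists [::].
move=> _ _ [v ->] [w ->].
suff [u ->] : exists u, (eval_word w)^-1%g = eval_word u.
  by exists (v ++ u); rewrite eval_word_cat.
elim: w => [|x w [u IHw]] /=; first by exists [::]; rewrite /= invg1.
exists (u ++ nseq 3 x); rewrite eval_word_cat -IHw.
case: x; rewrite invgM; congr (_ * _)%g; apply: mulg1_eq.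
  by rewrite /= mulg1 -a4.
by rewrite /= mulg1 -b4.
Qed.

Lemma G_ind (P : treeAut -> Prop) :
  P 1%g -> (forall f, G f -> P f -> P (a * f)%g) ->
  (forall f, G f -> P f -> P (b * f)%g) -> forall f, G f -> P f.
Proof.
move=> P1 Pa Pb f /G_eval_word[w ->].
suff [] : G (eval_word w) /\ P (eval_word w) by [].
elim: w => [|x w [IG IP]] //=.
by case: x; split; [exact: G_M|exact: Pa|exact: G_M|exact: Pb].
Qed.

Lemma G_Gamma f : G f -> Gamma f.
Proof. exact: Grigorchuk2_Gamma. Qed.

#[local] Hint Resolve G_Gamma : core.

Lemma sec1 x : sec 1%g x = 1%g.
Proof. by apply: treeAutP => v; rewrite /sec /= drop0. Qed.

Lemma G_bsec x : G (bsec x).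
Proof. by case: x => [[|[|[|[|x]]]] x4]. Qed.

(** G is self-similar, since the sections of a and b are in G. *)
Lemma G_sec f x : G f -> G (sec f x).
Proof.
move=> Gf; elim/G_ind: f / Gf x => [|f Gf IHf|f Gf IHf] x; first by rewrite sec1.
  by rewrite secM ?sec_a ?mul1g//; exact: Gamma_gen_a.
rewrite secM; last exact: Gamma_gen_b.
by rewrite sec_b; apply: G_M; [exact: G_bsec|exact: IHf].
Qed.

(** * Invariants modulo 4 *)

Definition bexp (f : treeAut) : 'I_4 := lbl (sec f 0) + lbl (sec f 1).

Definition cnt (f : treeAut) (j : 'I_4) : 'I_4 := bexp (sec f j).

(** The weights j + 1 make this vanish on b, whose only nonzero [cnt] is at
    j = 3; on G, another constant in place of 1 changes it by a multiple of
    [bexp]. *)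
Definition heis (f : treeAut) : 'I_4 := - \sum_j (j + 1) * cnt f j.

Definition hsum (f : treeAut) : 'I_4 := \sum_j heis (sec f j).

Lemma Z4P (P : 'I_4 -> Prop) : P 0 -> P 1 -> P 2 -> P 3 -> forall x, P x.
Proof.
move=> P0 P1 P2 P3 x.
have /or4P[] : [|| x == 0, x == 1, x == 2 | x == 3].
- by case: x => [[|[|[|[|x]]]] x4].
- by move/eqP->.
- by move/eqP->.
- by move/eqP->.
- by move/eqP->.
Qed.

Lemma Z4E :
  ((1 + 1 = 2 :> 'I_4)%R * (2 + 1 = 3 :> 'I_4)%R * (3 + 1 = 0 :> 'I_4)%R *
   (1 + 2 = 3 :> 'I_4)%R * (0 - 1 = 3 :> 'I_4)%R * (1 - 1 = 0 :> 'I_4)%R *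
   (2 - 1 = 1 :> 'I_4)%R * (3 - 1 = 2 :> 'I_4)%R)%type.
Proof. by do ![split]; exact: val_inj. Qed.

Lemma sumZ4 (V : nmodType) (F : 'I_4 -> V) : \sum_j F j = F 0 + F 1 + F 2 + F 3.
Proof.
rewrite !big_ord_recr big_ord0 /= add0r.
by congr (F _ + F _ + F _ + F _); apply: val_inj.
Qed.

Lemma lbl1 : lbl 1%g = 0. Proof. by []. Qed.
Lemma bsec0 : bsec 0 = a. Proof. by []. Qed.
Lemma bsec1 : bsec 1 = 1%g. Proof. by []. Qed.
Lemma bsec2 : bsec 2 = a. Proof. by []. Qed.
Lemma bsec3 : bsec 3 = b. Proof. by []. Qed.
Definition bsecE := (bsec0, bsec1, bsec2, bsec3).

Lemma lbl_bsec (x : 'I_4) : lbl (bsec x) = (~~ odd x)%:R.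
Proof. by elim/Z4P: x; rewrite bsecE ?lbl_a ?lbl_b ?lbl1. Qed.

Lemma bexp1 : bexp 1%g = 0. Proof. by rewrite /bexp !sec1 lbl1 addr0. Qed.
Lemma bexp_a : bexp a = 0. Proof. by rewrite /bexp !sec_a lbl1 addr0. Qed.
Lemma bexp_b : bexp b = 1.
Proof. by rewrite /bexp !sec_b !bsecE lbl_a lbl1 addr0. Qed.

Lemma cnt1 j : cnt 1%g j = 0. Proof. by rewrite /cnt sec1 bexp1. Qed.
Lemma cnt_a j : cnt a j = 0. Proof. by rewrite /cnt sec_a bexp1. Qed.
Lemma cnt_b j : cnt b j = (j == 3)%:R.
Proof. by rewrite /cnt sec_b; elim/Z4P: j; rewrite bsecE ?bexp_a ?bexp1 ?bexp_b. Qed.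

Lemma sec_aM f j : sec (a * f)%g j = sec f (j + 1).
Proof. by rewrite (secM _ _ Gamma_gen_a) lbl_a sec_a mul1g. Qed.

Lemma sec_bM f j : sec (b * f)%g j = (bsec j * sec f j)%g.
Proof. by rewrite (secM _ _ Gamma_gen_b) lbl_b sec_b addr0. Qed.

(** On the first level b acts by the labels 1, 0, 1, 0, and a moves a pair of
    opposite letters to a pair of opposite letters. *)
Lemma lbl_sec_per f x : G f -> lbl (sec f (x + 2)) = lbl (sec f x).
Proof.
move=> Gf; elim/G_ind: f / Gf x => [|f Gf IHf|f Gf IHf] x; first by rewrite !sec1.
  by rewrite !sec_aM addrAC IHf.
have Gs y : Gamma (sec f y) := G_Gamma (G_sec y Gf).
rewrite !sec_bM !lblM// ?IHf; try exact: G_Gamma (G_bsec _).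
by congr (_ + _); rewrite !lbl_bsec; elim/Z4P: x.
Qed.

Lemma bexp_shift f x : G f -> lbl (sec f x) + lbl (sec f (x + 1)) = bexp f.
Proof.
move=> Gf; have := lbl_sec_per 0 Gf; have := lbl_sec_per 1 Gf.
rewrite /bexp add0r Z4E => P1 P0; elim/Z4P: x; rewrite ?Z4E ?add0r// ?P0 ?P1//.
  by rewrite addrC.
by rewrite addrC.
Qed.

(** The factor f may rotate the two letters at which [bexp g] is read, which is
    harmless by periodicity. *)
Lemma bexpM f g : Gamma f -> G g -> bexp (f * g)%g = bexp f + bexp g.
Proof.
move=> Gf Gg; rewrite -(bexp_shift (lbl f) Gg) /bexp !secM// !lblM; try exact: Gamma_sec.
- by rewrite add0r (addrC 1) addrACA.
- exact/Gamma_sec/(G_Gamma Gg).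
- exact/Gamma_sec/(G_Gamma Gg).
Qed.

Lemma cntM f g j : Gamma f -> G g ->
  cnt (f * g)%g j = cnt f j + cnt g (j + lbl f).
Proof.
by move=> Gf Gg; rewrite /cnt secM// bexpM//; [exact: Gamma_sec|exact: G_sec].
Qed.

Lemma cnt_aM f j : G f -> cnt (a * f)%g j = cnt f (j + 1).
Proof.
move=> Gf; rewrite (cntM _ Gamma_gen_a Gf) lbl_a.
by rewrite cnt_a add0r.
Qed.

Lemma cnt_bM f j : G f -> cnt (b * f)%g j = (j == 3)%:R + cnt f j.
Proof.
move=> Gf; rewrite (cntM _ Gamma_gen_b Gf) lbl_b.
by rewrite cnt_b addr0.
Qed.

(** The conjugate of b counted by [cnt f k] has the section b at k, the
    section a at both neighbours of k, and the trivial section opposite to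
    k. *)
Lemma lbl_sec f j : G f -> lbl (sec f j) = cnt f (j - 1) + cnt f (j + 1).
Proof.
move=> Gf; elim/G_ind: f / Gf j => [|f Gf IHf|f Gf IHf] j.
- by rewrite sec1 !cnt1 addr0.
- by rewrite sec_aM IHf !cnt_aM// (addrAC j).
- rewrite sec_bM (lblM (G_Gamma (G_bsec j)) (G_Gamma (G_sec j Gf))) IHf.
  rewrite !cnt_bM// [RHS]addrACA lbl_bsec.
  by congr (_ + _); elim/Z4P: j; exact: val_inj.
Qed.

Lemma bexpE f : G f -> bexp f = \sum_j cnt f j.
Proof.
move=> Gf; rewrite /bexp !lbl_sec// sumZ4.
rewrite !Z4E add0r; ring.
Qed.

(** This is the multiplication of the Heisenberg group: f rotates the
    positions of the conjugates of b in g by [lbl f], and so shifts all the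
    weights in [heis g]. *)
Lemma heisM f g : G f -> G g ->
  heis (f * g)%g = heis f + heis g + lbl f * bexp g.
Proof.
move=> Gf Gg; rewrite /heis (bexpE Gg) -opprD -[lbl f * _]opprK -opprD.
congr (- _); under eq_bigr => j _ do rewrite (cntM j (G_Gamma Gf) Gg) mulrDr.
rewrite big_split/= -addrA; congr (_ + _); apply/esym.
rewrite mulr_sumr -sumrB (reindex_inj (addIr (lbl f))) /=.
by apply: eq_bigr => j _; ring.
Qed.

Lemma heis1 : heis 1%g = 0.
Proof. by rewrite /heis big1 ?oppr0// => j _; rewrite cnt1 mulr0. Qed.
Lemma heis_a : heis a = 0.
Proof. by rewrite /heis big1 ?oppr0// => j _; rewrite cnt_a mulr0. Qed.
Lemma heis_b : heis b = 0.
Proof. by rewrite /heis sumZ4 !cnt_b; apply: val_inj. Qed.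

(** Multiplying f by b on the left adds 1 to [cnt f 3] and, by the Heisenberg
    cocycle, [cnt f 2 + cnt f 0] to the sum of the central coordinates: the
    labels of the sections of b are nonzero at 0 and 2 only.  The quadratic form
    on the right changes by the same amount. *)
Lemma hsumE f : G f -> hsum f = \sum_j cnt f j * cnt f (j + 1).
Proof.
move=> Gf; elim/G_ind: f / Gf => [|f Gf IHf|f Gf IHf].
- by rewrite /hsum !big1// => j _; rewrite ?sec1 ?heis1// cnt1 mul0r.
- rewrite /hsum in IHf *; under eq_bigr => j _ do rewrite sec_aM.
  rewrite [in RHS](eq_bigr (fun j => cnt f (j + 1) * cnt f (j + 1 + 1))) => [|j _].
    transitivity (\sum_j heis (sec f j)).
      by rewrite [in RHS](reindex_inj (addIr (1 : 'I_4))).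
    by rewrite IHf [in LHS](reindex_inj (addIr (1 : 'I_4))).
  by rewrite !cnt_aM.
- have hE j : heis (sec (b * f)%g j) = heis (sec f j) + lbl (bsec j) * cnt f j.
    rewrite sec_bM (heisM (G_bsec j) (G_sec j Gf)).
    have -> : heis (bsec j) = 0.
      by elim/Z4P: j; rewrite bsecE ?heis_a ?heis_b ?heis1.
    by rewrite add0r.
  rewrite /hsum; under eq_bigr => j _ do rewrite hE.
  rewrite big_split /= -/(hsum f) IHf !sumZ4 !lbl_bsec !cnt_bM//=.
  rewrite !Z4E add0r /=; ring.
Qed.

(** * Tuples supported on one coordinate *)

Definition single (j : 'I_4) (g : treeAut) (x : 'I_4) : treeAut :=
  if x == j then g else 1%g.

(** The rigid stabiliser of the letter 0 in G, identified with a group of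
    sections.  It turns out to be the third term of the lower central series
    of G. *)
Definition rist g := G g /\ G (mk (single 0 g)).

Lemma mkJa_X k t : ((mk t) ^ (a ^+ k) = mk (fun x => t (x - k%:R)))%g.
Proof.
elim: k t => [|k IHk] t.
  by rewrite expg0 conjg1; apply: eq_mk => x; rewrite subr0.
rewrite expgSr conjgM IHk conjgE mkJa; apply: eq_mk => x.
by rewrite -natr1 opprD addrAC addrA.
Qed.

Lemma rot_G t k : G (mk t) -> G (mk (fun x => t (x - k))).
Proof.
by move=> Gt; rewrite -(natr_Zp k) -mkJa_X; apply: G_J => //; exact: G_X.
Qed.

Lemma rist_at g j : rist g -> G (mk (single j g)).
Proof.
move=> [_ /(@rot_G _ j)]; rewrite (_ : mk _ = mk (single j g))//.
by apply: eq_mk => x; rewrite /single subr_eq0.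
Qed.

Lemma rist1 : rist 1%g.
Proof.
split=> //; rewrite (_ : mk _ = 1%g)//.
by rewrite -[RHS]mk1; apply: eq_mk => x; rewrite /single; case: ifP.
Qed.

Lemma ristM f g : rist f -> rist g -> rist (f * g)%g.
Proof.
move=> [Gf mf] [Gg mg]; split; first exact: G_M.
rewrite (_ : mk _ = mk (single 0 f) * mk (single 0 g))%g; first exact: G_M.
by rewrite mkM; apply: eq_mk => x; rewrite /single; case: ifP => // _; rewrite mulg1.
Qed.

Lemma ristV f : rist f -> rist (f^-1)%g.
Proof.
move=> [Gf mf]; split; first exact: G_V.
rewrite (_ : mk _ = (mk (single 0 f))^-1)%g; first exact: G_V.
by rewrite mkV; apply: eq_mk => x; rewrite /single; case: ifP => // _; rewrite invg1.
Qed.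

Lemma mk_bsec k : G (mk (fun x => bsec (x + k))).
Proof.
rewrite (_ : mk _ = mk (fun x => bsec (x - (- k)))); last by rewrite opprK.
by apply: rot_G; rewrite -b_mk.
Qed.

(** A conjugate of b with section a at 0, and another one with section b at 0,
    realise the conjugation by the generators. *)
Lemma ristJ g h : rist g -> G h -> rist (g ^ h)%g.
Proof.
move=> Ng Gh; elim/G_ind: h / Gh g Ng => [|h Gh IHh|h Gh IHh] g Ng.
- by rewrite conjg1.
- rewrite conjgM; apply: IHh; case: Ng => [Gg mg]; split; first exact: G_J.
  rewrite (_ : mk _ = (mk (single 0 g)) ^ (mk (fun x => bsec (x + 0))))%g.
    by apply: G_J => //; exact: mk_bsec.
  rewrite [RHS]conjgE mkV !mkM; apply: eq_mk => x; rewrite /single addr0.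
  by case: eqP => [->|_]; rewrite ?bsecE// mul1g mulVg.
- rewrite conjgM; apply: IHh; case: Ng => [Gg mg]; split; first exact: G_J.
  rewrite (_ : mk _ = (mk (single 0 g)) ^ (mk (fun x => bsec (x + 3))))%g.
    by apply: G_J => //; exact: mk_bsec.
  rewrite [RHS]conjgE mkV !mkM; apply: eq_mk => x; rewrite /single.
  by case: eqP => [->|_]; rewrite ?add0r ?bsecE// mul1g mulVg.
Qed.

(** Locked to keep the commutator folded inside products. *)
Definition c := locked [~ a, b]%g.

Lemma cE : c = [~ a, b]%g. Proof. by rewrite /c -lock. Qed.

Lemma G_c : G c. Proof. by rewrite cE; exact: G_R. Qed.
#[local] Hint Resolve G_c : core.

(** The commutator of (a, 1, a, b) and (b, a, 1, a). *)
Definition csec (x : 'I_4) : treeAut :=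
  match val x with 0 => c | 3 => c^-1 | _ => 1 end%g.

Lemma mk_R s t : [~ mk s, mk t]%g = mk (fun x => [~ s x, t x]%g).
Proof. by rewrite commgEl conjgE !mkV !mkM. Qed.

Lemma csec0 : csec 0 = c. Proof. by []. Qed.
Lemma csec1 : csec 1 = 1%g. Proof. by []. Qed.
Lemma csec2 : csec 2 = 1%g. Proof. by []. Qed.
Lemma csec3 : csec 3 = (c^-1)%g. Proof. by []. Qed.
Definition csecE := (csec0, csec1, csec2, csec3).

Lemma mk_csec : G (mk csec).
Proof.
rewrite (_ : csec = fun x => [~ bsec (x + 0), bsec (x + 3)]%g).
  by rewrite -mk_R; apply: G_R; exact: mk_bsec.
apply/funext; elim/Z4P; rewrite addr0 csecE ?add0r.
- by rewrite !bsecE cE.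
- rewrite (_ : 1 + 3 = 0); last exact: val_inj.
  by rewrite !bsecE comm1g.
- rewrite (_ : 2 + 3 = 1); last exact: val_inj.
  by rewrite !bsecE commg1.
- rewrite (_ : 3 + 3 = 2); last exact: val_inj.
  by rewrite !bsecE cE invgR.
Qed.

(** Commute (c, 1, 1, c^-1) with (a, b, a, 1), whose last coordinate is
    trivial. *)
Lemma rist_ca : rist [~ c, a]%g.
Proof.
split; first exact: G_R.
rewrite (_ : single 0 _ = fun x => [~ csec x, bsec (x + 2)]%g).
  by rewrite -mk_R; apply: G_R; [exact: mk_csec|exact: mk_bsec].
apply/funext; elim/Z4P; rewrite csecE /single /= ?comm1g ?add0r ?bsecE//.
by rewrite (_ : 3 + 2 = 1) ?bsecE ?commg1//; exact: val_inj.
Qed.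

(** Commuting (c^-1, c, 1, 1) with (b, a, 1, a) gives ([c^-1, b], [c, a], 1, 1),
    and the second coordinate can be removed by [rist_ca]. *)
Lemma rist_cVb : rist [~ c^-1, b]%g.
Proof.
split; first by apply: G_R => //; exact: G_V.
pose t x := [~ csec (x - 1), bsec (x + 3)]%g.
have Gt : G (mk t).
  by rewrite -mk_R; apply: G_R; [exact: (rot_G _ mk_csec)|exact: mk_bsec].
have Gca := G_V (rist_at 1 rist_ca).
rewrite (_ : mk _ = mk t * (mk (single 1%R [~ c, a]))^-1)%g; first exact: G_M.
rewrite mkV mkM; apply: eq_mk; elim/Z4P; rewrite /t /single Z4E csecE /=.
- by rewrite add0r bsecE invg1 mulg1.
- by rewrite (_ : 1 + 3 = 0) ?bsecE ?mulgV//; exact: val_inj.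
- by rewrite comm1g mul1g invg1.
- by rewrite comm1g mul1g invg1.
Qed.

(** * The quotient by the rigid stabiliser *)

Definition eq_rist f g := rist (f^-1 * g)%g.

Lemma eq_rist_refl f : eq_rist f f.
Proof. by rewrite /eq_rist mulVg; exact: rist1. Qed.

Lemma eq_rist_sym f g : eq_rist f g -> eq_rist g f.
Proof. by move=> /ristV; rewrite /eq_rist invgM invgK. Qed.

Lemma eq_rist_trans g f h : eq_rist f g -> eq_rist g h -> eq_rist f h.
Proof. by move=> fg gh; have := ristM fg gh; rewrite /eq_rist -mulgA mulKVg. Qed.

Lemma eq_rist_l h f g : eq_rist f g -> eq_rist (h * f)%g (h * g)%g.
Proof. by rewrite /eq_rist invgM -mulgA mulKg. Qed.

Lemma eq_rist_r h f g : G h -> eq_rist f g -> eq_rist (f * h)%g (g * h)%g.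
Proof.
by move=> Gh fg; have := ristJ fg Gh; rewrite /eq_rist conjgE invgM !mulgA.
Qed.

Lemma eq_rist_commX h k : G h -> eq_rist (c * h)%g (h * c)%g ->
  eq_rist (c * h ^+ k)%g (h ^+ k * c)%g.
Proof.
move=> Gh ch; elim: k => [|k IHk]; first by rewrite expg0 mulg1 mul1g; exact: eq_rist_refl.
rewrite expgS; apply: (@eq_rist_trans (h * c * h ^+ k)%g).
  by rewrite mulgA; apply: eq_rist_r => //; exact: G_X.
by rewrite -!mulgA; apply: eq_rist_l.
Qed.

Lemma eq_rist_ca : eq_rist (c * a)%g (a * c)%g.
Proof. by apply: eq_rist_sym; rewrite /eq_rist invgM -mulgA -commgEl; exact: rist_ca. Qed.

Lemma eq_rist_cb : eq_rist (c * b)%g (b * c)%g.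
Proof.
have := ristJ rist_cVb G_c.
by rewrite /eq_rist commgEl !conjgE !invgM !invgK -!mulgA mulKg.
Qed.

(** Modulo [rist], c is central and ab = bac. *)
Lemma eq_rist_abX k : eq_rist (a * b ^+ k)%g (b ^+ k * a * c ^+ k)%g.
Proof.
elim: k => [|k IHk]; first by rewrite !expg0 !mulg1 mul1g; exact: eq_rist_refl.
rewrite {1}expgS mulgA (commgC a b) -cE -!mulgA.
apply: (@eq_rist_trans (b * (a * (b ^+ k * c)))%g).
  by do 2 apply: eq_rist_l; apply: eq_rist_commX => //; exact: eq_rist_cb.
rewrite expgS expgSr -!mulgA; apply: eq_rist_l.
by rewrite !mulgA; apply: eq_rist_r => //; rewrite mulgA in IHk *.
Qed.

(** Moving a across b^4 = 1 produces c^4. *)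
Lemma rist_c4 : rist (c ^+ 4)%g.
Proof.
have := eq_rist_abX 4; rewrite b4 mulg1 mul1g.
by rewrite /eq_rist mulKg.
Qed.

(** Normal form of the elements of a group of class 2 generated by a and b. *)
Lemma eq_rist_normal g : G g ->
  exists i j k, eq_rist (b ^+ j * a ^+ i * c ^+ k)%g g.
Proof.
move=> Gg; elim/G_ind: g / Gg => [|f Gf [i [j [k IHf]]]|f Gf [i [j [k IHf]]]].
- by exists 0%N, 0%N, 0%N; rewrite !expg0 !mulg1; exact: eq_rist_refl.
- exists i.+1, j, (j + k)%N; apply: eq_rist_trans (eq_rist_l a IHf).
  rewrite !mulgA.
  apply: (@eq_rist_trans (b ^+ j * a * c ^+ j * a ^+ i * c ^+ k)%g); last first.
    apply: eq_rist_r; first exact: G_X.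
    apply: eq_rist_r; first exact: G_X.
    exact: eq_rist_sym (eq_rist_abX j).
  rewrite expgS expgnDr -!mulgA; do 2 apply: eq_rist_l; rewrite !mulgA.
  apply: eq_rist_r; first exact: G_X.
  elim: j {IHf} => [|j IHj]; first by rewrite expg0 mulg1 mul1g; exact: eq_rist_refl.
  rewrite expgSr; apply: (@eq_rist_trans (c ^+ j * a ^+ i * c)%g).
    by rewrite mulgA; apply: eq_rist_r.
  rewrite -!mulgA; apply: eq_rist_l; apply: eq_rist_sym.
  by apply: eq_rist_commX => //; exact: eq_rist_ca.
- by exists i, j.+1, k; rewrite expgS -!mulgA; apply: eq_rist_l; rewrite !mulgA.
Qed.

(** For f = (g, 1, 1, 1) only [cnt f 0 = bexp g] can be nonzero.  By [lbl_sec]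
    the label of the section at 0 is 0, and the trivial label of the section at 1
    is [cnt f 0]; then [hsumE] gives the central coordinate. *)
Lemma rist_inv g : rist g -> [/\ lbl g = 0, bexp g = 0 & heis g = 0].
Proof.
move=> [Gg mg]; pose f := mk (single 0 g).
have sE j : sec f j = single 0 g j by rewrite sec_mk.
have s1E j : j != 0 -> sec f j = 1%g by rewrite sE /single => /negPf->.
have n1 : cnt f 1 = 0 by rewrite /cnt s1E ?bexp1.
have n2 : cnt f 2 = 0 by rewrite /cnt s1E ?bexp1.
have n3 : cnt f 3 = 0 by rewrite /cnt s1E ?bexp1.
have n0 : cnt f 0 = bexp g by rewrite /cnt sE.
have := lbl_sec 0 mg; rewrite -/f sE Z4E add0r n1 n3 addr0 => g0.
have := lbl_sec 1 mg; rewrite -/f s1E// !Z4E n0 n2 addr0 lbl1 => g1.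
have := hsumE mg; rewrite -/f /hsum !sumZ4 !Z4E n1 n2 n3 (s1E 1)// (s1E 2)// (s1E 3)// sE heis1.
by rewrite mulr0 !mul0r !addr0 add0r n1 mulr0 => gh; split.
Qed.

(** The derived subgroup of G, as [lbl] and [bexp] are the coordinates of the
    abelianisation. *)
Definition abker : set treeAut := [set f | [/\ G f, lbl f = 0 & bexp f = 0]]%classic.

Lemma lbl_c : lbl c = 0.
Proof.
have Ga := Gamma_gen_a; have Gb := Gamma_gen_b; have Gc := G_Gamma G_c.
have := congr1 lbl (commgC a b); rewrite -cE !lblM//; last exact: GammaM.
by rewrite lbl_a lbl_b add0r addr0 -[LHS]addr0 => /addrI.
Qed.

Lemma bexp_c : bexp c = 0.
Proof.
have Ga := Gamma_gen_a; have Gb := Gamma_gen_b.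
have := congr1 bexp (commgC a b); rewrite -cE !bexpM//; last exact: GammaM.
by rewrite bexp_a bexp_b add0r addr0 -[LHS]addr0 => /addrI.
Qed.

Lemma heis_c : heis c = 1.
Proof.
have := congr1 heis (commgC a b); rewrite -cE !heisM//; last exact: G_M.
by rewrite bexp_c !heis_a !heis_b lbl_a lbl_b bexp_b mulr0 mulr1 mul0r !add0r !addr0.
Qed.

Lemma lblX f k : G f -> lbl (f ^+ k)%g = lbl f *+ k.
Proof.
move=> Gf; elim: k => [|k IHk]; first by rewrite expg0 lbl1.
by rewrite expgS (lblM (G_Gamma Gf) (G_Gamma (G_X k Gf))) IHk mulrS.
Qed.

Lemma bexpX f k : G f -> bexp (f ^+ k)%g = bexp f *+ k.
Proof.
move=> Gf; elim: k => [|k IHk]; first by rewrite expg0 bexp1.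
by rewrite expgS (bexpM (G_Gamma Gf) (G_X k Gf)) IHk mulrS.
Qed.

Lemma heisX f k : G f -> lbl f * bexp f = 0 -> heis (f ^+ k)%g = heis f *+ k.
Proof.
move=> Gf f0; elim: k => [|k IHk]; first by rewrite expg0 heis1.
rewrite expgS (heisM Gf (G_X k Gf)) IHk mulrS.
by rewrite bexpX// mulrnAr f0 mul0rn addr0.
Qed.

Lemma natZ4_eq0 k : k%:R = 0 :> 'I_4 -> exists m, k = (4 * m)%N.
Proof.
rewrite Zp_nat => /(congr1 val) /= k4.
by exists (k %/ 4)%N; rewrite {1}(divn_eq k 4) k4 addn0 mulnC.
Qed.

(** All three invariants vanish on [rist], so they can be computed on the normal
    form of g, where they are the exponents of a, b and c. *)
Lemma abker_cX g : abker g -> exists2 k, k%:R = heis g & eq_rist (c ^+ k)%g g.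
Proof.
move=> [Gg g0 g1]; have [i [j [k gE]]] := eq_rist_normal Gg.
set w := (b ^+ j * a ^+ i * c ^+ k)%g in gE.
have Gb : G (b ^+ j)%g by exact: G_X.
have Ga : G (a ^+ i)%g by exact: G_X.
have Gc : G (c ^+ k)%g by exact: G_X.
have Gba : G (b ^+ j * a ^+ i)%g by exact: G_M.
have Gw : G w by exact: G_M.
have Gn : G (w^-1 * g)%g by case: gE.
have gwn : g = (w * (w^-1 * g))%g by rewrite mulKVg.
have [n0 n1 n2] := rist_inv gE.
have wl : lbl w = i%:R.
  rewrite /w !lblM ?lblX ?lbl_a ?lbl_b ?lbl_c ?mul0rn ?add0r ?addr0//; exact: G_Gamma.
have wb : bexp w = j%:R.
  rewrite /w !bexpM ?bexpX ?bexp_a ?bexp_b ?bexp_c ?mul0rn ?add0r ?addr0//; exact: G_Gamma.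
have i0 : i%:R = 0 :> 'I_4.
  by rewrite -g0 gwn lblM ?wl ?n0 ?addr0//; exact: G_Gamma.
have j0 : j%:R = 0 :> 'I_4.
  by rewrite -g1 gwn bexpM ?wb ?n1 ?addr0//; exact: G_Gamma.
have [m im] := natZ4_eq0 i0; have [m' jm] := natZ4_eq0 j0.
have wE : w = (c ^+ k)%g.
  by rewrite /w im jm !expgnA a4 b4 !expg1n !mul1g.
exists k; last by rewrite -wE.
rewrite gwn heisM// n1 mulr0 addr0 n2 addr0 wE heisX ?heis_c//.
by rewrite lbl_c mul0r.
Qed.

(** * The image of psi *)

Lemma mk_prod (t : 'I_4 -> treeAut) : mk t =
  (mk (single 0 (t 0)) * mk (single 1%R (t 1%R)) * mk (single 2 (t 2)) * mk (single 3 (t 3)))%g.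
Proof.
by rewrite !mkM; apply: eq_mk; elim/Z4P; rewrite /single /= ?mul1g ?mulg1.
Qed.

Lemma rist_cX k : k%:R = 0 :> 'I_4 -> rist (c ^+ k)%g.
Proof.
move=> /natZ4_eq0[m ->]; rewrite expgnA.
elim: m => [|m IHm]; first exact: rist1.
by rewrite expgS; apply: ristM => //; exact: rist_c4.
Qed.

Lemma mk_X t k : (mk t ^+ k)%g = mk (fun x => t x ^+ k)%g.
Proof.
elim: k => [|k IHk]; first by rewrite expg0 -mk1; apply: eq_mk => x; rewrite expg0.
by rewrite expgS IHk mkM; apply: eq_mk => x; rewrite expgS.
Qed.

(** Write t x as c ^+ k x times an element of [rist].  The tuple of powers of c
    is then moved into the coordinate 0 by means of the tuples with c^-1 at 0
    and c at x, which are products of rotations of (c, 1, 1, c^-1); what is left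
    is (c ^+ K, 1, 1, 1) with K a multiple of 4. *)
Lemma G_mk t : (forall x, abker (t x)) -> \sum_x heis (t x) = 0 -> G (mk t).
Proof.
move=> Dt t0.
pose k x := projT1 (cid2 (abker_cX (Dt x))).
have kE x : (k x)%:R = heis (t x) by rewrite /k; case: cid2.
have tE x : eq_rist (c ^+ k x)%g (t x) by rewrite /k; case: cid2.
pose g1 := mk (fun x => csec (x - 1)).
pose g2 := mk (fun x => csec (x - 2)).
pose g3 := mk (fun x => csec (x - 3)).
have G1 : G g1 by exact: (rot_G _ mk_csec).
have G2 : G g2 by exact: (rot_G _ mk_csec).
have G3 : G g3 by exact: (rot_G _ mk_csec).
pose s x := (c ^+ k x)%g; pose n x := ((s x)^-1 * t x)%g.
have -> : mk t = (mk s * mk n)%g.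
  by rewrite mkM; apply: eq_mk => x; rewrite mulKVg.
apply: G_M; last first.
  have Gn x : G (mk (single x (n x))) by apply: rist_at; exact: tE.
  by rewrite mk_prod; do 3![apply: G_M (Gn _)]; exact: Gn.
(* The order of the terms lets the factors cancel from the inside out. *)
pose K := (k 0%R + k 3%R + k 2%R + k 1%R)%N.
have K0 : rist (c ^+ K)%g.
  by apply: rist_cX; rewrite /K !natrD !kE -[RHS]t0 sumZ4; ring.
rewrite (_ : mk s = mk (single 0%R (c ^+ K)) * (g1 ^+ k 1%R) * ((g1 * g2) ^+ k 2%R)
    * ((g1 * g2 * g3) ^+ k 3%R))%g; last first.
  have c0 : csec (0 - 2) = 1%g by [].
  have c1 : csec (1 - 2) = (c^-1)%g by [].
  have c2 : csec (2 - 2) = c by [].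
  have c3 : csec (3 - 2) = 1%g by [].
  have d0 : csec (0 - 3) = 1%g by [].
  have d1 : csec (1 - 3) = 1%g by [].
  have d2 : csec (2 - 3) = (c^-1)%g by [].
  have d3 : csec (3 - 3) = c by [].
  rewrite /g1 /g2 /g3 !mkM !mk_X !mkM; apply: eq_mk.
  elim/Z4P; rewrite /single /s /= !Z4E !csecE ?(c0, c1, c2, c3) ?(d0, d1, d2, d3).
  - by rewrite !mulg1 !expVgn /K !expgnDr !mulgK.
  - by rewrite !(mul1g, mulg1, mulgV, expg1n).
  - by rewrite !(mul1g, mulg1, mulgV, expg1n).
  - by rewrite !(mul1g, mulg1, mulgV, expg1n).
apply: G_M; last by apply: G_X; apply: G_M => //; exact: G_M.
apply: G_M; last by apply: G_X; exact: G_M.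
by apply: G_M; [case: K0|exact: G_X].
Qed.

(** The derived subgroup of the first level stabiliser, whose abelianisation has
    the four coordinates [cnt]. *)
Definition cntker : set treeAut :=
  [set f | [/\ G f, lbl f = 0 & forall j, cnt f j = 0]]%classic.

(** The group cntker is described one level below: the labels and exponents of
    the sections vanish by [lbl_sec], and the sum of their central coordinates
    is a quadratic form in the numbers [cnt] by [hsumE]. *)
Lemma cntkerP t : cntker (mk t) <->
  (forall x, abker (t x)) /\ \sum_x heis (t x) = 0.
Proof.
split=> [[Gt _ t0]|[Dt t0]].
  have tE x : sec (mk t) x = t x by rewrite sec_mk.
  split=> [x|].
    split; first by rewrite -tE; exact: G_sec.
      by rewrite -tE lbl_sec// !t0 addr0.
    by rewrite -tE; exact: t0.
  have := hsumE Gt; rewrite /hsum; under eq_bigr do rewrite tE; move=> ->.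
  by rewrite big1// => j _; rewrite t0 mul0r.
split; [exact: G_mk|exact: lbl_mk|move=> j].
by rewrite /cnt sec_mk; case: (Dt j).
Qed.

(** Take a product of powers of the conjugates of b; the last value is forced
    because [bexp] is the sum of the numbers [cnt]. *)
Lemma abker_cnt x y z : exists2 f, abker f &
  [/\ cnt f 0 = x, cnt f 1 = y, cnt f 2 = z & cnt f 3 = - (x + y + z)].
Proof.
pose r k := mk (fun x => bsec (x + k)).
have step k (i : 'I_4) g : G g -> lbl g = 0 -> exists2 h, G h & lbl h = 0 /\
    forall j, cnt h j = (j + k == 3)%:R * i + cnt g j.
  have Gr : G (r k) := mk_bsec k.
  move=> Gg g0; exists (r k ^+ i * g)%g; first exact: G_M (G_X i Gr) Gg.
  split; first by rewrite (lblM (G_Gamma (G_X i Gr)) (G_Gamma Gg)) lblX// g0 lbl_mk mul0rn addr0.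
  move=> j; rewrite -[X in _ * X]natr_Zp.
  move: (nat_of_ord i) => m; elim: m => [|m IHm]; first by rewrite expg0 mul1g mulr0 add0r.
  rewrite expgS -mulgA (cntM j (G_Gamma Gr) (G_M (G_X m Gr) Gg)) lbl_mk addr0 IHm.
  have -> : cnt (r k) j = (j + k == 3)%:R by rewrite -cnt_b /cnt sec_mk sec_b.
  by rewrite addrA -[m.+1%:R]natr1 mulrDr mulr1 [X in X + _]addrC.
have [h0 G0 [l0 c0]] := step 0 (- (x + y + z)) _ G_1 lbl1.
have [h1 G1 [l1 c1]] := step 1 z _ G0 l0.
have [h2 G2 [l2 c2]] := step 2 y _ G1 l1.
have [f Gf [lf cf]] := step 3 x _ G2 l2.
have {}cf j : cnt f j = (j + 3 == 3)%:R * x + ((j + 2 == 3)%:R * y +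
    ((j + 1 == 3)%:R * z + (j + 0 == 3)%:R * (- (x + y + z)))).
  by rewrite cf c2 c1 c0 cnt1 addr0.
have f0 : cnt f 0 = x by rewrite cf !mul0r mul1r !addr0.
have f1 : cnt f 1 = y by rewrite cf !mul0r mul1r !addr0 add0r.
have f2 : cnt f 2 = z by rewrite cf !mul0r mul1r addr0 !add0r.
have f3 : cnt f 3 = - (x + y + z) by rewrite cf !mul0r mul1r !add0r.
exists f; split=> //.
by rewrite bexpE// sumZ4 f0 f1 f2 f3 addrN.
Qed.

(** * Counting actions on a level *)

Definition lev n (H : set treeAut) : {set {ffun n.-tuple 'I_4 -> n.-tuple 'I_4}} :=
  [set r | `[< exists2 f, H f & level_action n f = r >]]%SET.

Lemma levP n H r : reflect (exists2 f, H f & level_action n f = r) (r \in lev n H).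
Proof. by rewrite inE; exact: asboolP. Qed.

Lemma lev_in n H f : H f -> level_action n f \in lev n H.
Proof. by move=> Hf; apply/levP; exists f. Qed.

Lemma subgroup_index_lev n H : subgroup H -> subgroup_index H (St H n) = #|lev n H|.
Proof.
move=> sH; rewrite index_StE// cardE.
apply: perm_size; apply: uniq_perm; [exact: fset_uniq|exact: enum_uniq|move=> r].
rewrite mem_enum in_fset_set; last exact: finite_finset.
by apply/idP/levP => [/set_mem[f]|[f]] Hf fr; [exists f|apply/mem_set; exists f].
Qed.

Lemma val_level_action n (f : treeAut) (t : n.-tuple 'I_4) :
  val (level_action n f t) = f (val t).
Proof. by rewrite ffunE val_insubd size_treeAut size_tuple eqxx. Qed.

Lemma level_actionM n (f g : treeAut) t :
  level_action n (f * g)%g t = level_action n g (level_action n f t).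
Proof. by apply: val_inj; rewrite !val_level_action. Qed.

Lemma level_action_inj n (f : treeAut) : injective (level_action n f).
Proof.
move=> s t /(congr1 val); rewrite !val_level_action.
by move=> /(bij_inj (treeAut_bij f)) /val_inj.
Qed.

(** Lagrange's theorem for the actions on level n.  The last two hypotheses make
    q a surjection from these actions, and its fibres are the translates of the
    actions of K; q may be any complete invariant of the cosets of K in H. *)
Lemma card_lev_fibres (Q : finType) (q : treeAut -> Q) (H K : set treeAut) n :
  subgroup H -> (K `<=` H)%classic ->
  (forall f g, H f -> H g -> q f = q g <-> K (f * g^-1)%g) ->
  (forall f g, H f -> H g -> level_action n f = level_action n g -> q f = q g) ->
  (forall y, exists2 f, H f & q f = y) ->
  #|lev n H| = (#|Q| * #|lev n K|)%N.
Proof.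
move=> sH KH qK qn qS.
have [qq qqE] : exists qq, forall f, H f -> qq (level_action n f) = q f.
  have ex r : exists y, forall f, H f -> level_action n f = r -> q f = y.
    have [[g Hg gr]|no] := pselect (exists2 g, H g & level_action n g = r).
      by exists (q g) => f Hf fr; apply: qn; rewrite // fr.
    by exists (q 1%g) => f Hf fr; case: no; exists f.
  exists (fun r => projT1 (cid (ex r))) => f Hf.
  by case: (cid _) => y /= yP; rewrite -(yP f).
rewrite -sum1_card (partition_big qq xpredT)//= -sum_nat_const.
apply: eq_bigr => y _; have [g Hg gy] := qS y.
pose mulr_g (r : {ffun n.-tuple 'I_4 -> n.-tuple 'I_4}) :=
  [ffun t => level_action n g (r t)].
have mulr_inj : injective mulr_g.
  move=> r s /ffunP rs; apply/ffunP => t; have := rs t; rewrite [LHS]ffunE [RHS]ffunE.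
  exact: level_action_inj.
have mulrE f : mulr_g (level_action n f) = level_action n (f * g)%g.
  by apply/ffunP => t; rewrite ffunE level_actionM.
rewrite sum1dep_card -(card_imset (mem (lev n K)) mulr_inj).
apply: eq_card => r; rewrite [LHS]inE; apply/andP/imsetP => [[/levP[f Hf <-]]|[_ /levP[f Kf <-] ->]].
  rewrite qqE// => /eqP fy; exists (level_action n (f * g^-1)%g).
    by apply/lev_in/qK; rewrite // gy.
  by rewrite mulrE mulgVK.
have Hfg : H (f * g)%g by apply: subgroupM => //; exact: KH.
rewrite mulrE; split; first exact: lev_in.
by rewrite qqE// -gy; apply/eqP/qK; rewrite // mulgK.
Qed.

Lemma card_lev_trivial n (K : set treeAut) : K 1%g ->
  (forall (f : treeAut) u, K f -> size u = n -> f u = u) -> #|lev n K| = 1%N.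
Proof.
move=> K1 Kn; apply/eqP/cards1P; exists (level_action n 1%g).
apply/setP => r; rewrite inE; apply/levP/eqP => [[f Kf <-]|->]; last by exists 1%g.
by apply/level_actionP => u un; rewrite Kn.
Qed.

Definition mkset (B : set treeAut) : set treeAut :=
  [set f | exists2 t, (forall x, B (t x)) & f = mk t]%classic.

Lemma level_action_mk n s t : level_action n.+1 (mk s) = level_action n.+1 (mk t) <->
  forall x, level_action n (s x) = level_action n (t x).
Proof.
split=> [/level_actionP st x|st].
  by apply/level_actionP => u un; have := st (x :: u); rewrite /= un => /(_ erefl)[].
apply/level_actionP => -[|x u]//= [un]; congr (_ :: _).
by move: u un; apply/level_actionP/st.
Qed.

(** The action of [mk t] on level n + 1 is an arbitrary 4-tuple of actions of the
    [t x] on level n. *)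
Lemma card_lev_mk n (B : set treeAut) : #|lev n.+1 (mkset B)| = (#|lev n B| ^ 4)%N.
Proof.
have := @card_ffun_on 'I_4 _ (mem (lev n B)); rewrite card_ord => <-.
have ex (r : {ffun 'I_4 -> {ffun n.-tuple 'I_4 -> n.-tuple 'I_4}}) :
    exists h, forall t, (forall x, level_action n (t x) = r x) ->
      level_action n.+1 (mk t) = h.
  have [[s sr]|no] := pselect (exists s, forall x, level_action n (s x) = r x).
    by exists (level_action n.+1 (mk s)) => t tr; apply/level_action_mk => x; rewrite sr.
  by exists (level_action n.+1 1%g) => t tr; case: no; exists t.
pose F r := projT1 (cid (ex r)).
have FE t : F [ffun x => level_action n (t x)] = level_action n.+1 (mk t).
  by rewrite /F; case: cid => h /= /(_ t) <-// x; rewrite ffunE.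
have onP r : r \in ffun_on (lev n B) ->
    exists2 t, (forall x, B (t x)) & r = [ffun x => level_action n (t x)].
  move=> /ffun_onP rB.
  have exx x : exists2 f, B f & level_action n f = r x by apply/levP/rB.
  exists (fun x => projT1 (cid2 (exx x))) => [x|]; first by case: cid2.
  by apply/ffunP => x; rewrite ffunE; case: cid2.
have Finj : {in ffun_on (lev n B) &, injective F}.
  move=> r s /onP[t _ ->] /onP[t' _ ->]; rewrite !FE => /level_action_mk tt'.
  by apply/ffunP => x; rewrite !ffunE.
rewrite -(card_in_imset Finj); apply: eq_card => h.
apply/levP/imsetP => [[_ [t Bt ->] <-]|[_ /onP[t Bt ->] ->]]; last first.
  by exists (mk t); rewrite ?FE//; exists t.
exists [ffun x => level_action n (t x)]; last by rewrite FE.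
by apply/ffun_onP => x; rewrite ffunE; exact: lev_in.
Qed.

Lemma level_action_lbl n f g : level_action n.+1 f = level_action n.+1 g -> lbl f = lbl g.
Proof.
by move=> /level_actionP /(level_eq_le (ltn0Sn n)) fg; rewrite /lbl fg.
Qed.

Lemma level_action_sec n f g x :
  level_action n.+1 f = level_action n.+1 g -> level_action n (sec f x) = level_action n (sec g x).
Proof.
move=> /level_actionP fg; apply/level_actionP => u un.
by rewrite /sec /= fg//= un.
Qed.

Lemma level_action_bexp n f g : level_action n.+2 f = level_action n.+2 g -> bexp f = bexp g.
Proof.
move=> fg; rewrite /bexp.
by congr (_ + _); apply: (@level_action_lbl n); exact: level_action_sec.
Qed.

Lemma level_action_cnt n f g j : level_action n.+3 f = level_action n.+3 g -> cnt f j = cnt g j.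
Proof. by move=> fg; apply: (@level_action_bexp n); exact: level_action_sec. Qed.

Lemma level_action_heis n f g : level_action n.+3 f = level_action n.+3 g -> heis f = heis g.
Proof.
by move=> fg; rewrite /heis; congr (- _); apply: eq_bigr => j _; rewrite (level_action_cnt j fg).
Qed.

Lemma level_action_hsum n f g : level_action n.+4 f = level_action n.+4 g -> hsum f = hsum g.
Proof.
move=> fg; apply: eq_bigr => j _.
by apply: (@level_action_heis n); exact: level_action_sec.
Qed.

(** * Orders of the congruence quotients *)

Lemma G_lblV f g : G f -> G g -> lbl (f * g^-1)%g = lbl f - lbl g.
Proof.
move=> Gf Gg; rewrite -{2}(mulgVK g f) (lblM _ (G_Gamma Gg)) ?addrK//.
by apply: G_Gamma; apply: G_M Gf (G_V Gg).
Qed.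

Lemma G_bexpV f g : G f -> G g -> bexp (f * g^-1)%g = bexp f - bexp g.
Proof.
move=> Gf Gg; rewrite -{2}(mulgVK g f) (bexpM _ Gg) ?addrK//.
by apply: G_Gamma; apply: G_M Gf (G_V Gg).
Qed.

Lemma G_cntV f g j : G f -> G g -> lbl f = lbl g ->
  cnt (f * g^-1)%g j = cnt f j - cnt g j.
Proof.
move=> Gf Gg fg; have GV : G (f * g^-1)%g := G_M Gf (G_V Gg).
rewrite -{2}(mulgVK g f) (cntM _ (G_Gamma GV) Gg) G_lblV// fg subrr addr0.
by rewrite addrK.
Qed.

Lemma subgroup_abker : subgroup abker.
Proof.
apply/subgroupP; split=> [|f g [Gf f0 f1] [Gg g0 g1]].
  by split; rewrite ?lbl1 ?bexp1.
split; first exact: G_M Gf (G_V Gg).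
  by rewrite G_lblV// f0 g0 subrr.
by rewrite G_bexpV// f1 g1 subrr.
Qed.

Lemma abkerV f g : abker f -> abker g -> abker (f * g^-1)%g.
Proof. by have [_] := (subgroupP _).1 subgroup_abker; apply. Qed.

Lemma heisV f g : abker f -> abker g -> heis (f * g^-1)%g = heis f - heis g.
Proof.
move=> Df Dg; have [GV _ _] := abkerV Df Dg; have [Gg _ g0] := Dg.
by rewrite -{2}(mulgVK g f) (heisM GV Gg) g0 mulr0 addr0 addrK.
Qed.

Lemma card_lev_G n : #|lev n.+2 G| = (16 * #|lev n.+2 abker|)%N.
Proof.
rewrite (@card_lev_fibres _ (fun f => (lbl f, bexp f)) G abker).
- by rewrite card_prod !card_ord.
- exact: subgroup_Grigorchuk2.
- by move=> f [].
- move=> f g Gf Gg; split=> [E|[_]].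
    have fg : lbl f = lbl g := congr1 fst E.
    have fg' : bexp f = bexp g := congr1 snd E.
    split; first exact: G_M Gf (G_V Gg).
      by rewrite G_lblV// fg subrr.
    by rewrite G_bexpV// fg' subrr.
  rewrite G_lblV// G_bexpV// => /eqP; rewrite subr_eq0 => /eqP ->.
  by move=> /eqP; rewrite subr_eq0 => /eqP ->.
- move=> f g Gf Gg fg; congr (_, _); last exact: level_action_bexp fg.
  exact: level_action_lbl fg.
- move=> [i j]; exists (a ^+ i * b ^+ j)%g; first exact: G_M (G_X i G_a) (G_X j G_b).
  have Ga := G_X i G_a; have Gb := G_X j G_b.
  rewrite (lblM (G_Gamma Ga) (G_Gamma Gb)) (bexpM (G_Gamma Ga) Gb).
  rewrite !lblX// !bexpX// lbl_a lbl_b bexp_a bexp_b !mul0rn addr0 add0r.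
  by rewrite !natr_Zp.
Qed.

Lemma card_lev_abker n : #|lev n.+3 abker| = (64 * #|lev n.+3 cntker|)%N.
Proof.
rewrite (@card_lev_fibres _ (fun f => (cnt f 0, cnt f 1, cnt f 2)) abker cntker).
- by rewrite !card_prod !card_ord.
- exact: subgroup_abker.
- move=> f [Gf f0 fc]; split=> //; rewrite bexpE// big1// => j _; exact: fc.
- move=> f g Df Dg; have [Gf f0 f1] := Df; have [Gg g0 g1] := Dg.
  have fg : lbl f = lbl g by rewrite f0.
  have cV j := G_cntV j Gf Gg fg.
  split=> [E|[_ _ e]].
    have e0 : cnt f 0 = cnt g 0 := congr1 (fun p => p.1.1) E.
    have e1 : cnt f 1 = cnt g 1 := congr1 (fun p => p.1.2) E.
    have e2 : cnt f 2 = cnt g 2 := congr1 snd E.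
    split; first exact: G_M Gf (G_V Gg).
      by rewrite G_lblV// fg subrr.
    move=> j; rewrite cV; apply/eqP; rewrite subr_eq0; apply/eqP.
    elim/Z4P: j => //.
    have := bexpE Gf; have := bexpE Gg; rewrite f1 g1 !sumZ4 e0 e1 e2.
    by move=> gE fE; apply: (addrI (cnt g 0 + cnt g 1 + cnt g 2)); rewrite -fE -gE.
  have eE j : cnt f j = cnt g j.
    by apply/eqP; rewrite -subr_eq0 -cV e.
  by rewrite !eE.
- by move=> f g _ _ fg; rewrite !(level_action_cnt _ fg).
- by move=> [[x y] z]; have [f Df [fx fy fz _]] := abker_cnt x y z; exists f; rewrite ?fx ?fy ?fz.
Qed.

Lemma subgroup_mkset_abker : subgroup (mkset abker).
Proof.
apply/subgroupP; split.
  by exists (fun=> 1%g); rewrite ?mk1// => _; have [] := (subgroupP _).1 subgroup_abker.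
move=> _ _ [s Ds ->] [t Dt ->]; exists (fun x => s x * (t x)^-1)%g.
  by move=> x; exact: abkerV.
by rewrite mkV mkM.
Qed.

Lemma hsum_mk t : hsum (mk t) = \sum_x heis (t x).
Proof. by apply: eq_bigr => j _; rewrite sec_mk. Qed.

Lemma cntkerE : cntker = [set f | mkset abker f /\ hsum f = 0]%classic.
Proof.
apply/seteqP; split=> f.
  move=> Kf; have [Gf f0 _] := Kf.
  have fE : f = mk (sec f) by rewrite mk_sec//; exact: G_Gamma.
  rewrite fE in Kf *; have [Ds s0] := (cntkerP _).1 Kf.
  by split; [exists (sec f)|rewrite hsum_mk].
by move=> [[t Dt ->]]; rewrite hsum_mk => t0; apply/cntkerP.
Qed.

Lemma hsumV f g : mkset abker f -> mkset abker g ->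
  hsum (f * g^-1)%g = hsum f - hsum g.
Proof.
move=> [s Ds ->] [t Dt ->]; rewrite mkV mkM !hsum_mk -sumrB.
by apply: eq_bigr => x _; rewrite heisV.
Qed.

Lemma abker1 : abker 1%g.
Proof. by have [] := (subgroupP _).1 subgroup_abker. Qed.

Lemma hsum_onto y : exists2 f, mkset abker f & hsum f = y.
Proof.
have [h Dh [h0 h1 h2 _]] := abker_cnt (- y) 0 0.
exists (mk (single 0 h)).
  by exists (single 0 h) => // x; rewrite /single; case: ifP => // _; exact: abker1.
rewrite hsum_mk sumZ4 /single /= heis1 !addr0 /heis sumZ4 h0 h1 h2.
by rewrite !Z4E mul0r !mulr0 !addr0 add0r mul1r opprK.
Qed.

Lemma card_lev_cntker n : (#|lev n.+3 abker| ^ 4 = 4 * #|lev n.+4 cntker|)%N.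
Proof.
rewrite -card_lev_mk (@card_lev_fibres _ hsum (mkset abker) cntker).
- by rewrite card_ord.
- exact: subgroup_mkset_abker.
- by rewrite cntkerE => f [].
- move=> f g Ef Eg; rewrite cntkerE; split=> [fg|[_]].
    split; last by rewrite hsumV// fg subrr.
    by have [_] := (subgroupP _).1 subgroup_mkset_abker; apply.
  by rewrite hsumV// => /eqP; rewrite subr_eq0 => /eqP.
- by move=> f g _ _; exact: level_action_hsum.
- exact: hsum_onto.
Qed.

(** Modulo 2, [heis f] is [cnt f 0 + cnt f 2], which is a label of the first
    level.  Level 2 thus determines [heis] modulo 2, but not modulo 4. *)
Lemma heis_parity f : abker f -> odd (heis f) = odd (lbl (sec f 1)).
Proof.
move=> [Gf _ _]; rewrite lbl_sec// !Z4E /heis sumZ4.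
by elim/Z4P: (cnt f 0); elim/Z4P: (cnt f 2); elim/Z4P: (cnt f 1); elim/Z4P: (cnt f 3).
Qed.

Definition mk_even : set treeAut :=
  [set f | mkset abker f /\ ~~ odd (hsum f)]%classic.

Lemma oddB (x y : 'I_4) : odd (x - y)%R = odd x (+) odd y.
Proof. by elim/Z4P: x; elim/Z4P: y. Qed.

Lemma oddD4 (x y : 'I_4) : odd (x + y)%R = odd x (+) odd y.
Proof. by elim/Z4P: x; elim/Z4P: y. Qed.

Lemma card_lev_even : (#|lev 2 abker| ^ 4 = 2 * #|lev 3 mk_even|)%N.
Proof.
rewrite -card_lev_mk (@card_lev_fibres _ (fun f => odd (hsum f)) (mkset abker) mk_even).
- by rewrite card_bool.
- exact: subgroup_mkset_abker.
- by move=> f [].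
- move=> f g Ef Eg; split=> /= [fg|[_]].
    split; last by rewrite hsumV// oddB fg addbb.
    by have [_] := (subgroupP _).1 subgroup_mkset_abker; apply.
  by rewrite hsumV// oddB negb_add => /eqP.
- move=> _ _ [s Ds ->] [t Dt ->] /level_action_mk st; rewrite !hsum_mk !sumZ4 !oddD4.
  have E x : odd (heis (s x)) = odd (heis (t x)).
    rewrite !heis_parity//; congr odd; congr nat_of_ord.
    by apply: (@level_action_lbl 0); exact: level_action_sec.
  by rewrite !E.
- by move=> y; have [f Ef fy] := hsum_onto (y%:R); exists f; rewrite ?fy//; case: y {fy}.
Qed.

(** The exponents 1, 0, -1, 0 are those of the quotient of two opposite
    conjugates of b, whose actions on level 2 agree. *)
Lemma abker_heis2 : exists2 h, abker h /\ heis h = 2 & forall u, size u = 2%N -> h u = u.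
Proof.
have [h Dh [h0 h1 h2 h3]] := abker_cnt 1 0 (-1).
have [Gh hl _] := Dh.
exists h.
  by split=> //; rewrite /heis sumZ4 h0 h1 h2 h3; exact: val_inj.
have hs x : lbl (sec h x) = 0.
  by rewrite lbl_sec//; elim/Z4P: x; rewrite !Z4E ?add0r ?h0 ?h1 ?h2 ?h3; exact: val_inj.
move=> [|x [|y []]]//= _.
rewrite (treeAut_cons _ _ (G_Gamma Gh)) hl (Gamma_letter _ (G_Gamma (G_sec x Gh))).
by rewrite hs !addr0.
Qed.

(** An element of [mk_even] whose coordinate sum is 2 can be corrected by an
    element of [abker_heis2] placed at one letter, with no effect on level 3. *)
Lemma lev3_mk_even : lev 3 mk_even = lev 3 cntker.
Proof.
apply/setP => r; apply/levP/levP => -[f]; last first.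
  rewrite cntkerE => -[Ef f0] <-; exists f => //; split=> //.
  by rewrite f0.
move=> [Ef ev] <-.
have [h0|h2] : hsum f = 0 \/ hsum f = 2.
  by move: (hsum f) ev; elim/Z4P => // _; [left|right].
- by exists f => //; rewrite cntkerE.
- have [h [Dh hh] h1] := abker_heis2.
  have Eh : mkset abker (mk (single 0 h)).
    exists (single 0 h) => // x; rewrite /single; case: ifP => // _; exact: abker1.
  exists (f * (mk (single 0 h))^-1)%g.
    rewrite cntkerE; split.
      by have [_] := (subgroupP _).1 subgroup_mkset_abker; apply.
    rewrite hsumV// h2 hsum_mk sumZ4 /single /= heis1 hh !addr0.
    by rewrite subrr.
  apply/level_actionP => u un.
  have mu (w : vertex) : size w = 3%N -> mk (single 0 h) w = w.
    case: w => [|x w]//= [wn]; rewrite /single; congr (_ :: _).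
    by case: ifP => // _; exact: h1.
  by rewrite treeAutME -{1}(mu (f u)) ?treeAutK// size_treeAut.
Qed.

(** On level 2 an element of abker acts by labels s, -s, s, -s. *)
Lemma card_lev2_abker : #|lev 2 abker| = 4%N.
Proof.
have Dlbl f u : abker f -> lbl (sec f 0) = 0 -> size u = 2%N -> f u = u.
  move=> [Gf fl fe]; case: u => [|x [|y []]]//= fs _.
  rewrite (treeAut_cons _ _ (G_Gamma Gf)) fl (Gamma_letter _ (G_Gamma (G_sec x Gf))).
  suff -> : lbl (sec f x) = 0 by rewrite !addr0.
  have f1 : lbl (sec f 1) = 0 by move: fe; rewrite /bexp fs add0r.
  elim/Z4P: x => //.
    by have := lbl_sec_per 0 Gf; rewrite add0r fs.
  by have := lbl_sec_per 1 Gf; rewrite Z4E f1.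
pose K := [set f | abker f /\ lbl (sec f 0) = 0]%classic.
rewrite (@card_lev_fibres _ (fun f => lbl (sec f 0)) abker K).
- rewrite card_ord card_lev_trivial ?muln1//.
    by split; [exact: abker1|rewrite sec1].
  by move=> f u [Df f0]; exact: Dlbl.
- exact: subgroup_abker.
- by move=> f [].
- move=> f g Df Dg; have [Gf f0 _] := Df; have [Gg g0 _] := Dg.
  have E : lbl (sec (f * g^-1)%g 0) = lbl (sec f 0) - lbl (sec g 0).
    have DV := abkerV Df Dg; have [GV v0 _] := DV.
    rewrite -{2}(mulgVK g f) (secM _ _ (G_Gamma GV)) v0 addr0.
    by rewrite (lblM (G_Gamma (G_sec _ GV)) (G_Gamma (G_sec _ Gg))) addrK.
  rewrite /K/=; split=> [fg|[_]].
    by split; [exact: abkerV|rewrite E fg subrr].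
  by rewrite E => /eqP; rewrite subr_eq0 => /eqP.
- by move=> f g _ _ fg; apply: (@level_action_lbl 0); exact: level_action_sec.
- move=> y; have [h Dh [h0 h1 h2 h3]] := abker_cnt (- y) 0 0; exists h => //.
  by case: Dh => Gh _ _; rewrite lbl_sec// !Z4E add0r h1 h3 !addr0 opprK.
Qed.

Lemma card_lev_lbl H n : subgroup H -> (H `<=` Gamma)%classic -> H a ->
  #|lev n.+1 H| = (4 * #|lev n.+1 [set f | H f /\ lbl f = 0%R]%classic|)%N.
Proof.
move=> sH HG Ha; pose K := [set f | H f /\ lbl f = 0]%classic.
have [H1 HV] := (subgroupP _).1 sH.
rewrite (@card_lev_fibres _ lbl H K) ?card_ord//.
- by move=> f [].
- move=> f g Hf Hg; have E : lbl (f * g^-1)%g = lbl f - lbl g.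
    by rewrite -{2}(mulgVK g f) (lblM (HG _ (HV _ _ Hf Hg)) (HG _ Hg)) addrK.
  rewrite /K /=; split=> [fg|[_]].
    by split; [exact: HV|rewrite E fg subrr].
  by rewrite E => /eqP; rewrite subr_eq0 => /eqP.
- by move=> f g _ _; exact: level_action_lbl.
- move=> y; rewrite -(natr_Zp y).
  suff aX k : H (a ^+ k)%g by exists (a ^+ y)%g => //; rewrite lblX ?lbl_a//.
  by elim: k => [|k IHk] //; rewrite expgS; exact: subgroupM.
Qed.

Lemma card_lev0 H : H 1%g -> #|lev 0 H| = 1%N.
Proof.
by move=> H1; apply: card_lev_trivial => // f [|//] _ _; exact: treeAut_root.
Qed.

Lemma card_lev_Gamma n : #|lev n.+1 Gamma| = (4 * #|lev n Gamma| ^ 4)%N.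
Proof.
rewrite card_lev_lbl//; [|exact: subgroup_Gamma|exact: Gamma_gen_a].
congr (4 * _)%N; rewrite -card_lev_mk; congr #|lev _ _|.
apply/seteqP; split=> [f [Gf f0]|_ [t Gt ->]].
  by exists (sec f) => [x|]; [exact: Gamma_sec|rewrite mk_sec].
by split; [exact: Gamma_mk|exact: lbl_mk].
Qed.

Lemma card_lev_Gamma_cube n : (4 * #|lev n Gamma| ^ 3 = 4 ^ (4 ^ n))%N.
Proof.
elim: n => [|n IHn].
  by rewrite card_lev0//; have [] := (subgroupP _).1 subgroup_Gamma.
rewrite card_lev_Gamma (expnSr 4 n) expnM -IHn.
by move: #|_| => g; ring.
Qed.

Lemma card_lev1_G : #|lev 1 G| = 4%N.
Proof.
rewrite card_lev_lbl//; [|exact: subgroup_Grigorchuk2|exact: Grigorchuk2_Gamma].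
rewrite card_lev_trivial ?muln1// => f [|x []]// [Gf f0] _.
by rewrite (Gamma_letter _ (G_Gamma Gf)) f0 addr0.
Qed.

Lemma card_lev2_G : #|lev 2 G| = 64%N.
Proof. by rewrite card_lev_G card_lev2_abker. Qed.

Lemma card_lev3_G : #|lev 3 G| = (2 ^ 17)%N.
Proof.
rewrite card_lev_G card_lev_abker -lev3_mk_even.
by have := card_lev_even; rewrite card_lev2_abker; lia.
Qed.

Lemma card_lev_G_rec n : (2 ^ 8 * #|lev n.+4 G| = #|lev n.+3 G| ^ 4)%N.
Proof.
rewrite !card_lev_G card_lev_abker expnMn card_lev_cntker; lia.
Qed.

(** The cube clears the denominator 3 of the exponent. *)
Lemma card_lev_G_cube m : (#|lev m.+3 G| ^ 3 = 2 ^ (43 * 4 ^ m + 8))%N.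
Proof.
elim: m => [|m IHm]; first by rewrite card_lev3_G -expnM.
(* Cube the recursion 2 ^ 8 * g_(n+1) = g_n ^ 4. *)
apply/eqP; rewrite -(eqn_pmul2l (_ : 0 < (2 ^ 8) ^ 3)%N) ?expn_gt0//.
rewrite -expnMn card_lev_G_rec -expnM mulnC expnM IHm -!expnM -expnD.
by apply/eqP; congr (2 ^ _)%N; rewrite expnS; lia.
Qed.

(** * Logarithms and the Hausdorff dimension *)

Section Real.
Variable R : realType.

Lemma ln4E : ln 4 = 2 * ln 2 :> R.
Proof. by rewrite (_ : 4 = 2 ^+ 2 :> R) ?lnXn ?mulr_natl//; rewrite -natrX. Qed.

Lemma ln2_gt0 : 0 < ln 2 :> R.
Proof. by rewrite ln_gt0// ltr1n. Qed.

Lemma ln_card_lev_G m :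
  ln (#|lev m.+3 G|%:R : R) = (43 * 4 ^+ m + 8) / 3 * ln 2.
Proof.
have g0 : 0 < #|lev m.+3 G|%:R :> R.
  rewrite ltr0n -(ltn_exp2r _ _ (isT : 0 < 3)%N) card_lev_G_cube exp0n// expn_gt0//.
have := congr1 (fun k => ln (k%:R : R)) (card_lev_G_cube m).
rewrite !natrX !lnXn// -[LHS]mulr_natl -[RHS]mulr_natl natrD natrM natrX.
move=> E; apply: (mulfI (_ : 3 != 0 :> R)); first by rewrite pnatr_eq0.
by rewrite E; field.
Qed.

Lemma ln_card_lev_Gamma n :
  ln (#|lev n Gamma|%:R : R) = (4 ^+ n - 1) / 3 * ln 4.
Proof.
have g0 : 0 < #|lev n Gamma|%:R :> R.
  rewrite ltr0n -(ltn_exp2r _ _ (isT : 0 < 3)%N) exp0n//.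
  by rewrite -(ltn_pmul2l (isT : 0 < 4)%N) card_lev_Gamma_cube muln0 expn_gt0.
have := congr1 (fun k => ln (k%:R : R)) (card_lev_Gamma_cube n).
have p4 : 0 < 4%:R :> R by rewrite ltr0n.
have pg : 0 < #|lev n Gamma|%:R ^+ 3 :> R by rewrite exprn_gt0.
rewrite natrM !natrX lnM ?posrE// (lnXn _ g0) (lnXn _ p4).
rewrite -[X in _ + X]mulr_natl -[RHS]mulr_natl natrX => E.
apply: (mulfI (_ : 3 != 0 :> R)); first by rewrite pnatr_eq0.
by rewrite -[LHS](addKr (ln 4)) E; field.
Qed.

Lemma ratioE m : (43 * 4 ^+ m + 8) / 3 * ln 2 / ((4 ^+ m.+3 - 1) / 3 * (2 * ln 2)) =
  (43 * 4 ^+ m + 8) / (128 * 4 ^+ m - 2) :> R.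
Proof.
have := ln2_gt0; set l := ln 2; have : 1 <= 4 ^+ m :> R by rewrite exprn_ege1// ler1n.
rewrite !exprS; set p := 4 ^+ m => p1 l0.
by field; rewrite !gt_eqF//; lra.
Qed.

(** Divide by 4 ^+ m. *)
Lemma ratio_cvg :
  ((43 * 4 ^+ m + 8) / (128 * 4 ^+ m - 2) @[m --> \oo] --> (43 / 128 : R))%classic.
Proof.
pose x m : R := 4^-1 ^+ m.
have x0 : (x @ \oo --> (0 : R))%classic.
  by apply: cvg_expr; rewrite ger0_norm ?invr_ge0// invf_lt1 ?ltr1n.
have -> : (fun m => (43 * 4 ^+ m + 8) / (128 * 4 ^+ m - 2)) =
    (fun m => (43 + 8 * x m) / (128 - 2 * x m) : R).
  apply/funext => m; rewrite /x exprVn.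
  have p0 : 4 ^+ m != 0 :> R by rewrite expf_neq0// pnatr_eq0.
  have p1 : 1 <= 4 ^+ m :> R by rewrite exprn_ege1// ler1n.
  have p2 : 128 * 4 ^+ m - 2 != 0 :> R by apply: lt0r_neq0; lra.
  by field; rewrite p0 p2.
have -> : 43 / 128 = (43 + 8 * 0) / (128 - 2 * 0) :> R by rewrite !mulr0 addr0 subr0.
apply: cvgM; first by apply: cvgD; [exact: cvg_cst|apply: cvgM => //; exact: cvg_cst].
apply: cvgV; first by rewrite mulr0 subr0 pnatr_eq0.
by apply: cvgB; [exact: cvg_cst|apply: cvgM => //; exact: cvg_cst].
Qed.
End Real.

Theorem theorem1 (R : realType) :
  (forall n : nat, (0 < n)%N ->
     log4 ((subgroup_index Grigorchuk2 (St Grigorchuk2 n))%:R : R) =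
     if n == 1%N then 1
     else if n == 2%N then 3
     else 1 / 3 * (86 * (4 : R) ^ (n%:Z - 4) + 4)) /\
  hdim_Gamma R (closure_Gamma Grigorchuk2) = (43 / 128)%:E.
Proof.
have l4 : ln 4 != 0 :> R by rewrite ln4E mulf_neq0 ?gt_eqF ?ln2_gt0// pnatr_eq0.
split=> [n n0|].
  rewrite /log4 (subgroup_index_lev n subgroup_Grigorchuk2).
  case: n n0 => [|[|[|m]]]//= _.
  - by rewrite card_lev1_G divff.
  - by rewrite card_lev2_G (_ : 64 = 4 ^+ 3 :> R) ?lnXn// -?natrX// -[X in X / _]mulr_natl mulfK.
  - rewrite ln_card_lev_G ln4E.
    have -> : (m.+3%:Z - 4 = m%:Z - 1)%R by lia.
    rewrite expfzDr ?pnatr_eq0// exprN1 -exprnP.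
    have := ln2_gt0 R; set l := ln 2; set p := 4 ^+ m => l0.
    by field; rewrite gt_eqF.
rewrite hdim_closure; [|exact: subgroup_Grigorchuk2|exact: Grigorchuk2_Gamma].
apply: (cvg_limn_einf_sup _).1.
apply: cvg_EFin; first exact: nearW.
rewrite -(cvg_shiftn 3) /=.
under eq_fun => m.
  rewrite addn3 (subgroup_index_lev _ subgroup_Grigorchuk2) (subgroup_index_lev _ subgroup_Gamma).
  rewrite ln_card_lev_G ln_card_lev_Gamma ln4E ratioE; over.
exact: ratio_cvg.
Qed.
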